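(* For every $k \geq 1$ and every $b \geq 1$, Max $b$-Save is polynomial-time solvable on $k$-caterpillars (for arbitrary initially burned vertex $s$ and arbitrary $S\subseteq V$).
   Context: A caterpillar is a tree whose vertices of degree at least $2$ induce a path $P$ (so every edge has at least one endpoint in $P$). A $k$-caterpillar ($k\ge 1$) is a tree obtained from a caterpillar by replacing any edge with exactly one endpoint in $P$ by a path of length at most $k$. Firefighter process with budget $b$: given a graph $G=(V,E)$ and a vertex $s\in V$, at time $0$ the vertex $s$ is burned and every other vertex is vulnerable. A protection strategy is a set $\Phi \subseteq V \times \{1,\dots,|V|\}$; vertex $v$ is protected at time $t$ if $(v,t)\in\Phi$. At each time step $t \ge 1$, the vertices $v$ with $(v,t)\in \Phi$ become protected (and stay protected forever), and then every vulnerable vertex (neither burned nor protected) adjacent to a burned vertex becomes burned at time $t+1$. $\Phi$ is valid with respect to budget $b$ if (1) whenever $(v,t)\in\Phi$, $v$ is not burned at time $t$, and (2) for each $t$, at most $b$ pairs $(v,t)$ lie in $\Phi$. A vertex is saved if it is protected or every path from a burned vertex to it contains a protected vertex. Max $b$-Save: given a graph $G=(V,E)$, a burned vertex $s\in V$ and $S\subseteq V$, find a valid strategy with respect to budget $b$ maximizing the number of saved vertices in $S$. *)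

(* Defs.v *)
From mathcomp Require Import all_boot.

Set Implicit Arguments.
Unset Strict Implicit.
Unset Printing Implicit Defensive.

(* Polynomial time.  The model of computation is first-order functional
   programming over binary trees (pure first-order LISP, a variant of F in
   N. D. Jones, "Computability and Complexity from a Programming
   Perspective").  Every construct does a constant amount of work on
   pointers -- one cell allocated, one cell inspected, or one environment
   built whose length is fixed by the program text -- and is charged one
   unit.  There is no primitive arithmetic and no primitive comparison of
   trees, so that t units of cost are t steps of a pointer machine, up to a
   constant depending on the program only: polynomial cost is Turing
   polynomial time. *)

Inductive data : Type := Nil | Cons of data & data.

Fixpoint data_size (d : data) : nat :=
  if d is Cons d1 d2 then (data_size d1 + data_size d2).+1 else 1.

(* Variables are de Bruijn indices into the environment.  [ECase e e0 e1]
   evaluates e0 if e is [Nil], and evaluates e1 with h (index 0) and t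
   (index 1) bound if e is [Cons h t].  [ECall f xs] calls the f-th function
   of the program on the current values of the variables xs, which become the
   variables 0, 1, ... of its body. *)
Inductive expr : Type :=
| EVar of nat
| ENil
| ECons of expr & expr
| ECase of expr & expr & expr
| ELet of expr & expr
| ECall of nat & seq nat.

Definition program := seq expr.

(* [eval p env e v t]: under env, the expression e has value v, at cost t. *)
Inductive eval (p : program) : seq data -> expr -> data -> nat -> Prop :=
| EvalVar env i : eval p env (EVar i) (nth Nil env i) 1
| EvalNil env : eval p env ENil Nil 1
| EvalCons env e1 e2 v1 v2 t1 t2 :
    eval p env e1 v1 t1 -> eval p env e2 v2 t2 ->
    eval p env (ECons e1 e2) (Cons v1 v2) (t1 + t2).+1
| EvalCaseNil env e e0 e1 v t t0 :
    eval p env e Nil t -> eval p env e0 v t0 ->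
    eval p env (ECase e e0 e1) v (t + t0).+1
| EvalCaseCons env e e0 e1 vh vt v t t1 :
    eval p env e (Cons vh vt) t -> eval p (vh :: vt :: env) e1 v t1 ->
    eval p env (ECase e e0 e1) v (t + t1).+1
| EvalLet env e1 e2 v1 v2 t1 t2 :
    eval p env e1 v1 t1 -> eval p (v1 :: env) e2 v2 t2 ->
    eval p env (ELet e1 e2) v2 (t1 + t2).+1
| EvalCall env f xs v t :
    eval p [seq nth Nil env x | x <- xs] (nth ENil p f) v t ->
    eval p env (ECall f xs) v t.+1.

Lemma eval_det p env e v1 t1 v2 t2 :
  eval p env e v1 t1 -> eval p env e v2 t2 -> v1 = v2 /\ t1 = t2.
Proof.
move=> ev1; elim: ev1 v2 t2 => {env e v1 t1}; intros;
  match goal with H : eval _ _ _ ?v ?t |- _ = ?v /\ _ => inversion H; subst end;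
  repeat match goal with
  | IH : (forall v t, eval ?p ?env ?e v t -> _), H : eval ?p ?env ?e _ _ |- _ =>
      let E := fresh in have [E ?] := IH _ _ H; clear IH H;
      try discriminate E; try (injection E as ? ?); subst
  end; by [].
Qed.

(* The search problem whose instances are the elements of I satisfying [dom],
   and whose acceptable answers on i are the d such that [sol i d].  The
   algorithm is function 0 of the program; as usual for a problem restricted to
   a class of inputs, nothing is asked of it outside of [dom]. *)
Definition polytime_solvable (I : Type) (enc : I -> data) (dom : I -> Prop)
    (sol : I -> data -> Prop) : Prop :=
  exists (p : program) (c d : nat), forall i : I, dom i ->
    exists (v : data) (t : nat),
      [/\ eval p [:: enc i] (nth ENil p 0) v t,
          t <= c * data_size (enc i) ^ d
        & sol i v].

Definition enc_bool (b : bool) : data := if b then Cons Nil Nil else Nil.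
Definition enc_nat (n : nat) : data := iter n (Cons Nil) Nil.
Definition enc_seq (l : seq data) : data := foldr Cons Nil l.

Section Trees.
Variables (T : finType) (e : rel T).

Definition is_tree : Prop :=
  [/\ symmetric e, irreflexive e, 0 < #|T|, (forall x y, connect e x y)
    & forall c : seq T, ucycle e c -> size c <= 2].

Definition degree (x : T) : nat := #|[set y | e x y]|.

(* The empty path and the one-vertex path are allowed. *)
Definition induces_path (P : {set T}) : Prop :=
  exists p : seq T,
    [/\ uniq p, p =i P
      & {in P &, forall x y,
           e x y = (index y p == (index x p).+1)
                   || (index x p == (index y p).+1)}].

Definition spine : {set T} := [set x | 1 < degree x].

Definition is_caterpillar : Prop := is_tree /\ induces_path spine.

(* An edge with exactly one endpoint in the spine is {x, y} with x a leaf and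
   y its unique neighbour, so the lengths of the paths replacing these edges
   are recorded at the leaves; [len x = 1] stands for no replacement, and is
   imposed at all vertices x that are not the leaf of such an edge. *)
Definition leg_lengths (k : nat) (len : T -> nat) : Prop :=
  forall x, 1 <= len x <= k /\
    (len x != 1 -> x \notin spine /\ exists2 y, y \in spine & e x y).

(* The replacement: the vertices replacing a leaf x with neighbour y are
   (x, 0), ..., (x, len x - 1), and the edge {x, y} becomes the path
   (y, 0), (x, 0), (x, 1), ..., (x, len x - 1), of length len x. *)
Definition replace_legs (len : T -> nat) : rel {x : T & 'I_(len x)} :=
  fun u v =>
    if tag u == tag v then
      (tagged v == (tagged u).+1 :> nat) || (tagged u == (tagged v).+1 :> nat)
    else [&& e (tag u) (tag v), tagged u == 0 :> nat & tagged v == 0 :> nat].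

End Trees.

Definition is_k_caterpillar (k : nat) (V : finType) (e : rel V) : Prop :=
  exists (T : finType) (e0 : rel T) (len : T -> nat)
         (f : V -> {x : T & 'I_(len x)}),
    [/\ is_caterpillar e0, leg_lengths e0 k len, bijective f
      & forall x y, e x y = replace_legs e0 (f x) (f y)].

Section Firefighter.
Variables (V : finType) (e : rel V) (s : V).

(* Subsets of V x {0, ..., |V|}; [valid] excludes time 0. *)
Definition strategy := {set V * 'I_#|V|.+1}.

Implicit Type Phi : strategy.

Definition protected_at Phi (t : nat) : {set V} :=
  [set v | [exists u : 'I_#|V|.+1, (u <= t) && ((v, u) \in Phi)]].

(* The vertices burned at time t, before the protections of time step t.  The
   fire first spreads during time step 1, so only s is burned at time 1. *)
Fixpoint burned_at Phi (t : nat) : {set V} :=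
  match t with
  | 0 => [set s]
  | 0.+1 => [set s]
  | t'.+1 =>
      burned_at Phi t' :|:
      [set v | (v \notin protected_at Phi t')
               && [exists u in burned_at Phi t', e u v]]
  end.

Definition valid (b : nat) Phi : Prop :=
  [/\ forall v t, (v, t) \in Phi -> 0 < t,
      forall v t, (v, t) \in Phi -> v \notin burned_at Phi t
    & forall t, #|[set v | (v, t) \in Phi]| <= b].

(* No protection takes place after time |V|, and the fire has stopped by then,
   see [burned_stable]. *)
Definition protected Phi : {set V} := protected_at Phi #|V|.
Definition burned Phi : {set V} := burned_at Phi #|V|.

Definition saved Phi : pred V := fun v =>
  (v \in protected Phi) ||
  [forall u in burned Phi,
     ~~ connect [rel x y | [&& e x y, x \notin protected Phi
                                    & y \notin protected Phi]] u v].

Definition num_saved (S : {set V}) Phi : nat := #|[set v in S | saved Phi v]|.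

Definition optimal (b : nat) (S : {set V}) Phi : Prop :=
  valid b Phi /\
  forall Psi : strategy, valid b Psi -> num_saved S Psi <= num_saved S Phi.

Lemma burned_atS Phi t : 0 < t ->
  burned_at Phi t.+1 = burned_at Phi t :|:
      [set v | (v \notin protected_at Phi t)
               && [exists u in burned_at Phi t, e u v]].
Proof. by case: t. Qed.

Lemma burned_stable Phi t : #|V| <= t -> burned_at Phi t = burned Phi.
Proof.
have V0 : 0 < #|V| by apply/card_gt0P; exists s.
have sub i : burned_at Phi i \subset burned_at Phi i.+1.
  by case: i => [|i]; [exact: subxx | rewrite (burned_atS Phi (ltn0Sn i)) subsetUl].
have protS i j : i <= j -> protected_at Phi i \subset protected_at Phi j.
  move=> ij; apply/subsetP => v; rewrite !inE => /existsP[u /andP[ui uP]].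
  by apply/existsP; exists u; rewrite uP (leq_trans ui ij).
have stop i : 0 < i -> burned_at Phi i.+1 = burned_at Phi i ->
    burned_at Phi i.+2 = burned_at Phi i.+1.
  move=> i0 eqi; apply/eqP; rewrite eqEsubset sub andbT.
  rewrite (burned_atS Phi (ltn0Sn i)) subUset subxx andTb.
  apply/subsetP => v; rewrite inE eqi => /andP[vP ve].
  rewrite -eqi (burned_atS Phi i0) inE [X in _ || X]inE ve andbT.
  by rewrite (contra _ vP) ?orbT //; apply/subsetP/protS.
have grow i : 0 < i -> (i <= #|burned_at Phi i|) \/
    burned_at Phi i.+1 = burned_at Phi i.
  elim: i => // -[_ _|i IH _]; first by left; rewrite cards1.
  have [le|E] := IH isT; last by right; apply: stop.
  case: (eqVneq (burned_at Phi i.+2) (burned_at Phi i.+1)) => [E|ne].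
    by right; apply: stop.
  left; apply: leq_ltn_trans le _; apply: proper_card.
  by rewrite properEneq eq_sym ne sub.
have base : burned_at Phi #|V|.+1 = burned_at Phi #|V|.
  have [le|//] := grow _ V0.
  have full : burned_at Phi #|V| = [set: V].
    by apply/eqP; rewrite eqEcard subsetT cardsT.
  by apply/eqP; rewrite eqEsubset sub andbT full subsetT.
move=> /subnKC <-; elim: (t - _) => [|i]; first by rewrite addn0.
rewrite addnS => <-; elim: i => [|i IH]; first by rewrite addn0.
by rewrite addnS; apply: stop => //; rewrite ltn_addr.
Qed.

Lemma savedP Phi v :
  reflect (v \in protected Phi \/
           forall (u : V) (p : seq V), u \in burned Phi -> path e u p ->
             last u p = v -> exists2 w, w \in u :: p & w \in protected Phi)
          (saved Phi v).
Proof.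
rewrite /saved; set P := protected Phi; set r := [rel x y | _].
apply: (iffP orP) => [[vP|/forall_inP H]|[vP|H]]; [by left| |by left|].
- right=> u p uB up pv; case: (boolP (has (mem P) (u :: p))) => [/hasP//|].
  move=> /hasPn noP; case/negP: (H u uB); apply/connectP; exists p => //.
  elim: p u up noP {pv uB} => //= w p IH u /andP[-> wp] noP.
  rewrite (noP u) ?mem_head// (noP w) ?inE ?eqxx ?orbT//= IH// => x xp.
  by apply: noP; rewrite inE xp orbT.
- case: (boolP (v \in P)) => [|vP]; [by left | right].
  apply/forall_inP => u uB; apply/negP => /connectP[p up vE].
  have ep : path e u p by apply: sub_path up => x y /and3P[].
  have [w wp wP] := H u p uB ep (esym vE).
  elim: p u up wp vE {uB ep} => [|y p IH] u /=.
    by rewrite inE => _ /eqP wu vu; rewrite vu -wu wP in vP.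
  case/andP=> /and3P[_ uP _] yp; rewrite inE => /orP[/eqP wu|wp] vE.
    by rewrite -wu wP in uP.
  exact: IH yp wp vE.
Qed.

End Firefighter.

Record instance := Instance {
  order : nat;
  adj : rel 'I_order;
  adj_sym : symmetric adj;
  adj_irr : irreflexive adj;
  source : 'I_order;
  targets : {set 'I_order}
}.

(* The adjacency matrix, s in unary, and the indicator sequence of S. *)
Definition enc_instance (I : instance) : data :=
  Cons (enc_seq [seq enc_seq [seq enc_bool (adj x y) | y <- enum 'I_(order I)]
                | x <- enum 'I_(order I)])
    (Cons (enc_nat (source I))
          (enc_seq [seq enc_bool (x \in targets I) | x <- enum 'I_(order I)])).

(* A strategy is output as a list of its elements, in any order.  As the depth
   of a value built at cost t is at most t more than that of the input, sharing
   cannot make such a list of unary numbers superpolynomially long. *)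
Definition enc_strategy (n m : nat) (l : seq ('I_n * 'I_m)) : data :=
  enc_seq [seq Cons (enc_nat (val vt.1)) (enc_nat (val vt.2)) | vt <- l].

Definition max_save_solution (b : nat) (I : instance) (d : data) : Prop :=
  exists l : seq ('I_(order I) * 'I_#|'I_(order I)|.+1),
    d = enc_strategy l /\
    optimal (@adj I) (source I) b (targets I) [set vt in l].

(* Main.v *)
Require Import Defs.
From mathcomp Require Import all_boot zify.
Import Defs.

Set Implicit Arguments.
Unset Strict Implicit.
Unset Printing Implicit Defensive.

(* In a tree rooted at s, a protection at time t may be moved to the ancestor at
   depth t, so a strategy amounts to a set A of vertices with at most b of them
   at each depth, and the burned vertices are those with no ancestor in A.  The
   algorithm simulates all these strategies in parallel, one depth at a time,
   keeping, among the runs with the same last two fronts (sets of vertices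
   burned at depths t - 1 and t), one with the fewest burned targets.

   The number of fronts is polynomial on k-caterpillars.  A vertex of A with a
   descendant at depth t either lies in one of the depths t - k + 1, ..., t, or
   has a descendant k levels below, in which case it lies on the path from s to
   one of the two ends of the spine, where only the topmost element of A
   matters.  Hence the front at depth t is determined by at most b k + 2
   vertices. *)

(** * Polynomial-time combinators *)

(** The program depends on [b] but not on [k], and it never roots the tree: it reads the adjacency
    matrix and tells the children of a front from its parents by looking at the previous front. This
    is why a key consists of two fronts, and why the number of runs kept is bounded by the square of
    the number of fronts. The graph class enters the analysis alone, through two vertices [z1], [z2]
    such that every vertex with a descendant [k] levels below is an ancestor of one of them.

    The polynomial bound is thus established only for instances in the class. The cost calculus
    therefore works over arbitrary context types, to be instantiated with the subtype of such
    instances, and its loop rules ask for a bound on all intermediate values, since polynomial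
    bounds on single steps do not compose along a loop.

    Moving a protection costs nothing because depth [t] catches fire only at time [t + 1]: the
    ancestor at depth [t] can still be protected at time [t], and it cuts off at least as much. *)

Class Enc (X : Type) := enc : X -> data.
#[local] Hint Mode Enc ! : typeclass_instances.
#[local] Instance Enc_unit : Enc unit := fun=> Nil.
#[local] Instance Enc_bool : Enc bool := enc_bool.
#[local] Instance Enc_nat : Enc nat := enc_nat.
#[local] Instance Enc_seq X `{Enc X} : Enc (seq X) := fun l => enc_seq (map enc l).
#[local] Instance Enc_prod X Y `{Enc X} `{Enc Y} : Enc (X * Y) :=
  fun xy => Cons (enc xy.1) (enc xy.2).

(** An inhabitant of [A] is the typed reading of an environment. All environments of a context have
    one length because the variables passed by [ECall] are fixed in the program text. *)
Class Ctx (A : Type) := {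
  env : A -> seq data;
  width : nat;
  size_env : forall a, size (env a) = width }.

Lemma size_env_ext A X `{Ctx A} `{Enc X} (ax : A * X) :
  size (enc ax.2 :: env ax.1) = (width (A := A)).+1.
Proof. by rewrite /= size_env. Qed.

#[local] Instance Ctx_ext A X `{Ctx A} `{Enc X} : Ctx (A * X) :=
  {| size_env := @size_env_ext A X _ _ |}.

Definition dsz X `{Enc X} (x : X) := data_size (enc x).

Arguments dsz {X _}.

(** The successor keeps the size positive even in the empty environment, so that raising the
    exponent never lowers [c * csize a ^ d]. *)
Definition csize A `{Ctx A} (a : A) := (sumn (map data_size (env a))).+1.

Arguments csize {A _}.

Lemma csize_ext A X `{Ctx A} `{Enc X} (a : A) (x : X) :
  csize (a, x) = dsz x + csize a.
Proof. by rewrite /csize /= addnS. Qed.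

Lemma dsz_gt0 X `{Enc X} (x : X) : 0 < dsz x.
Proof. by rewrite /dsz; case: (enc x). Qed.

Lemma dsz_cons X `{Enc X} (x : X) l : dsz (x :: l) = (dsz x + dsz l).+1.
Proof. by []. Qed.

Lemma dsz_pair X Y `{Enc X} `{Enc Y} (x : X) (y : Y) :
  dsz (x, y) = (dsz x + dsz y).+1.
Proof. by []. Qed.

Lemma dsz_bool (b : bool) : dsz b <= 3.
Proof. by case: b. Qed.

Lemma dsz_nat n : dsz n = n.*2.+1.
Proof.
elim: n => // n IH; rewrite -[LHS]/((1 + dsz n).+1) IH doubleS.
by rewrite add1n.
Qed.

Lemma dsz_cat X `{Enc X} (l1 l2 : seq X) :
  dsz (l1 ++ l2) + 1 = dsz l1 + dsz l2.
Proof. by elim: l1 => [|x l1 IH] /=; rewrite ?dsz_cons; [rewrite addnC | lia]. Qed.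

Lemma size_dsz X `{Enc X} (l : seq X) : size l < dsz l.
Proof. by elim: l => // x l IH; rewrite dsz_cons /=; lia. Qed.

(** Elements are given by splittings of the list because [\in] would require a decidable equality on
    [X]. *)
Lemma dsz_seq_le X `{Enc X} (l : seq X) m :
  (forall l1 x l2, l = l1 ++ x :: l2 -> dsz x <= m) -> dsz l <= size l * m.+1 + 1.
Proof.
elim: l => // x l IH lm; rewrite dsz_cons /= mulSn.
have := lm [::] x l erefl; have := IH (fun l1 y l2 E => lm (x :: l1) y l2 (congr1 _ E)).
by lia.
Qed.

Section Polynomial.
Context {A : Type} `{Ctx A}.

Definition PB (f : A -> nat) := exists c d, forall a, f a <= c * csize a ^ d.

Lemma PB_le f g : PB g -> (forall a, f a <= g a) -> PB f.
Proof. by move=> [c [d gB]] fg; exists c, d => a; exact: leq_trans (fg a) (gB a). Qed.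

Lemma PB_const n : PB (fun=> n).
Proof. by exists n, 0 => a; rewrite expn0 muln1. Qed.

Lemma PB_csize : PB csize.
Proof. by exists 1, 1 => a; rewrite mul1n expn1. Qed.

Lemma PB_add f g : PB f -> PB g -> PB (fun a => f a + g a).
Proof.
move=> [c [d fB]] [c' [d' gB]]; exists (c + c'), (d + d') => a.
rewrite mulnDl leq_add //.
  by apply: leq_trans (fB a) _; rewrite leq_mul2l leq_pexp2l ?orbT // leq_addr.
by apply: leq_trans (gB a) _; rewrite leq_mul2l leq_pexp2l ?orbT // leq_addl.
Qed.

Lemma PB_mul f g : PB f -> PB g -> PB (fun a => f a * g a).
Proof.
move=> [c [d fB]] [c' [d' gB]]; exists (c * c'), (d + d') => a.
by rewrite expnD mulnACA leq_mul.
Qed.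

Lemma PB_exp f d : PB f -> PB (fun a => f a ^ d).
Proof.
move=> fB; elim: d => [|d IH]; first exact: PB_const 1.
by apply: (PB_le (PB_mul fB IH)) => a; rewrite expnS.
Qed.

Lemma PB_poly c d f : PB f -> PB (fun a => c * f a ^ d).
Proof. by move=> fB; apply: PB_mul (PB_const c) _; apply: PB_exp. Qed.

End Polynomial.

Definition embeds (Q : program) (o : nat) (p : program) :=
  forall i, i < size p -> nth ENil Q (o + i) = nth ENil p i.

Lemma embeds_cat Q o p1 p2 : embeds Q o (p1 ++ p2) ->
  embeds Q o p1 /\ embeds Q (o + size p1) p2.
Proof.
move=> E; split=> i ip.
  by rewrite E ?nth_cat ?ip // size_cat ltn_addr.
by rewrite -addnA E ?size_cat ?ltn_add2l // nth_cat ltnNge leq_addr addKn.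
Qed.

Lemma embeds_cons Q o e p : embeds Q o (e :: p) ->
  nth ENil Q o = e /\ embeds Q o.+1 p.
Proof.
move=> E; split; first by have := E 0 isT; rewrite addn0.
by move=> i ip; rewrite addSnnS E.
Qed.

(** Argument lists of this form make a call drop the first [size pre] variables: weakening is done
    by calls, without shifting indices inside an expression. *)
Lemma env_iota (pre l : seq data) :
  [seq nth Nil (pre ++ l) x | x <- iota (size pre) (size l)] = l.
Proof.
apply: (@eq_from_nth _ Nil); first by rewrite size_map size_iota.
move=> i; rewrite size_map size_iota => il.
by rewrite (nth_map 0) ?size_iota // nth_iota // nth_cat ltnNge leq_addr addKn.
Qed.

(* [o] is the index at which the auxiliary functions are loaded: code fragments
   are combined by concatenation, without renumbering calls. *)
Definition PT A X `{Ctx A} `{Enc X} (F : A -> X) :=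
  PB (fun a => dsz (F a)) /\
  exists (m : nat) (p : nat -> program) (e : nat -> expr) (T : A -> nat),
    [/\ forall o, size (p o) = m, PB T
      & forall o Q, embeds Q o (p o) -> forall a,
          exists2 t, eval Q (env a) (e o) (enc (F a)) t & t <= T a].

Section Rules.
Context {A : Type} `{CA : Ctx A}.

(** Programs see encodings only, so types whose encodings coincide share their rules: [0], [false]
    and [tt] are empty lists, [true], a successor and a nonempty list are pairs. *)
Lemma PT_enc X Y `{Enc X} `{Enc Y} (F : A -> X) (G : A -> Y) :
  (forall a, enc (F a) = enc (G a)) -> PT F -> PT G.
Proof.
move=> FG [sF [m [p [e [T [mE TB ev]]]]]]; split.
  by apply: (PB_le sF) => a; rewrite /dsz FG.
by exists m, p, e, T; split=> // o Q /ev evQ a; have [t] := evQ a; rewrite FG; exists t.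
Qed.

Lemma PT_ext X `{Enc X} (F G : A -> X) : F =1 G -> PT F -> PT G.
Proof. by move=> FG; apply: PT_enc => a; rewrite FG. Qed.

Lemma PT_snd X `{Enc X} : PT (fun ax : A * X => ax.2).
Proof.
split; first by apply: (PB_le PB_csize) => -[a x]; rewrite csize_ext leq_addr.
exists 0, (fun=> [::]), (fun=> EVar 0), (fun=> 1); split=> //; first exact: PB_const.
by move=> o Q _ [a x]; exists 1 => //; exact: (EvalVar Q [:: enc x & env a] 0).
Qed.

Lemma PB_fst X `{Enc X} (f : A -> nat) : PB f -> PB (fun ax : A * X => f ax.1).
Proof.
move=> [c [d fB]]; exists c, d => -[a x] /=; rewrite csize_ext.
apply: leq_trans (fB a) _; rewrite leq_mul2l; apply/orP; right.
by case: (posnP d) => [->//|d0]; rewrite leq_exp2r // leq_addl.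
Qed.

(** In the longer environment the code of [F] would read the wrong indices, so it becomes a function
    called on the environment without its head. *)
Lemma PT_fst X Y `{Enc X} `{Enc Y} (F : A -> X) :
  PT F -> PT (fun ay : A * Y => F ay.1).
Proof.
move=> [sF [m [p [e [T [mE TB ev]]]]]]; split; first exact: PB_fst sF.
exists m.+1, (fun o => e o.+1 :: p o.+1),
  (fun o => ECall o (iota 1 (width (A := A)))), (fun ay => 1 + T ay.1); split.
- by move=> o /=; rewrite mE.
- exact: PB_add (PB_const 1) (PB_fst TB).
move=> o Q /[swap] [[a y]] /embeds_cons [oE /ev -/(_ a) [t tE tT]]; exists t.+1 => //.
apply: EvalCall; rewrite oE -(size_env a) /=.
by rewrite (env_iota [:: enc y] (env a)).
Qed.

Lemma PT_nil X `{Enc X} : PT (fun=> [::] : seq X).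
Proof.
split; first exact: PB_const 1.
exists 0, (fun=> [::]), (fun=> ENil), (fun=> 1); split=> //; first exact: PB_const.
by move=> o Q _ a; exists 1 => //; exact: EvalNil.
Qed.

Lemma PT_tt : PT (fun=> tt).
Proof. by apply: PT_enc (@PT_nil unit _). Qed.

Lemma PT_0 : PT (fun=> 0).
Proof. by apply: PT_enc (@PT_nil unit _). Qed.

Lemma PT_false : PT (fun=> false).
Proof. by apply: PT_enc (@PT_nil unit _). Qed.

Lemma PT_pair X Y `{Enc X} `{Enc Y} (F : A -> X) (G : A -> Y) :
  PT F -> PT G -> PT (fun a => (F a, G a)).
Proof.
move=> [sF [m [p [e [T [mE TB ev]]]]]] [sG [m' [p' [e' [T' [mE' TB' ev']]]]]].
split; first by apply: (PB_le (PB_add (PB_add sF sG) (PB_const 1))) => a; rewrite addn1.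
exists (m + m'), (fun o => p o ++ p' (o + m)), (fun o => ECons (e o) (e' (o + m))),
  (fun a => (T a + T' a) + 1); split.
- by move=> o; rewrite size_cat mE mE'.
- by apply: PB_add (PB_const 1); apply: PB_add.
move=> o Q /[swap] a /embeds_cat []; rewrite mE => /ev /(_ a) [t tE tT].
move=> /ev' /(_ a) [t' tE' tT']; exists (t + t').+1; last by lia.
exact: EvalCons tE tE'.
Qed.

Lemma PT_true : PT (fun=> true).
Proof. by apply: PT_enc (PT_pair PT_tt PT_tt). Qed.

Lemma PT_cons X `{Enc X} (F : A -> X) (G : A -> seq X) :
  PT F -> PT G -> PT (fun a => F a :: G a).
Proof. by move=> pF pG; apply: PT_enc (PT_pair pF pG). Qed.

Lemma PT_S (F : A -> nat) : PT F -> PT (fun a => (F a).+1).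
Proof. by move=> pF; apply: PT_enc (PT_pair PT_tt pF). Qed.

Lemma PT_proj (i : nat) X Y `{Enc X} `{Enc Y} (F : A -> X) (G : A -> Y) :
  (forall a, dsz (G a) <= dsz (F a)) ->
  (forall a, enc (G a) = if enc (F a) is Cons h t then nth Nil [:: h, t & env a] i
                         else Nil) ->
  PT F -> PT G.
Proof.
move=> GF GE [sF [m [p [e [T [mE TB ev]]]]]]; split; first exact: (PB_le sF).
exists m, p, (fun o => ECase (e o) ENil (EVar i)), (fun a => T a + 2); split=> //.
  exact: PB_add TB (PB_const 2).
move=> o Q /[swap] a /ev /(_ a) [t tE tT]; exists (t + 1).+1; last by lia.
rewrite GE; case: (enc (F a)) tE => [|h u] tE.
  by apply: EvalCaseNil tE _; exact: EvalNil.
by apply: EvalCaseCons tE _; exact: EvalVar.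
Qed.

Lemma PT_1 X Y `{Enc X} `{Enc Y} (F : A -> X * Y) : PT F -> PT (fun a => (F a).1).
Proof.
apply: (PT_proj (i := 0)) => a; last by case: (F a).
by case: (F a) => x y; rewrite dsz_pair /=; lia.
Qed.

Lemma PT_2 X Y `{Enc X} `{Enc Y} (F : A -> X * Y) : PT F -> PT (fun a => (F a).2).
Proof.
apply: (PT_proj (i := 1)) => a; last by case: (F a).
by case: (F a) => x y; rewrite dsz_pair /=; lia.
Qed.

Lemma PT_behead X `{Enc X} (F : A -> seq X) : PT F -> PT (fun a => behead (F a)).
Proof.
apply: (PT_proj (i := 1)) => a; last by case: (F a).
by case: (F a) => [|x l] //; rewrite dsz_cons /=; lia.
Qed.

Lemma PT_pred (F : A -> nat) : PT F -> PT (fun a => (F a).-1).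
Proof.
apply: (PT_proj (i := 1)) => a; last by case: (F a).
by rewrite !dsz_nat; lia.
Qed.

(** [true] is a [Cons], so the positive branch runs with two more variables bound; it is wrapped in
    a function that receives the original environment. *)
Lemma PT_if (b : A -> bool) X `{Enc X} (F G : A -> X) :
  PT b -> PT F -> PT G -> PT (fun a => if b a then F a else G a).
Proof.
move=> [_ [m [p [e [T [mE TB ev]]]]]] [sF [m' [p' [e' [T' [mE' TB' ev']]]]]].
move=> [sG [m'' [p'' [e'' [T'' [mE'' TB'' ev'']]]]]].
split; first by apply: (PB_le (PB_add sF sG)) => a; case: (b a); lia.
exists (m + (m'' + m'.+1)),
  (fun o => p o ++ (p'' (o + m) ++
     (e' (o + m + m'').+1 :: p' (o + m + m'').+1))),
  (fun o => ECase (e o) (e'' (o + m)) (ECall (o + m + m'') (iota 2 (width (A := A))))),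
  (fun a => T a + (T' a + T'' a) + 2); split.
- by move=> o; rewrite !size_cat /= mE mE' mE''.
- by apply: PB_add (PB_const 2); apply: PB_add => //; apply: PB_add.
move=> o Q /[swap] a /embeds_cat []; rewrite mE => /ev /(_ a) [t tE tT].
move=> /embeds_cat []; rewrite mE'' => /ev'' /(_ a) [t'' tE'' tT''].
move=> /embeds_cons [oE /ev' /(_ a) [t' tE' tT']].
case: (b a) tE => tE.
  exists (t + t'.+1).+1; last by lia.
  apply: EvalCaseCons tE _; apply: EvalCall; rewrite oE -(size_env a).
  by rewrite (env_iota [:: Nil; Nil] (env a)).
by exists (t + t'').+1; [exact: EvalCaseNil tE tE'' | lia].
Qed.

Lemma PT_head X `{Enc X} (x0 : A -> X) (F : A -> seq X) :
  PT x0 -> PT F -> PT (fun a => head (x0 a) (F a)).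
Proof.
move=> [sx [m [p [e [T [mE TB ev]]]]]] [sF [m' [p' [e' [T' [mE' TB' ev']]]]]].
split.
  apply: (PB_le (PB_add sx sF)) => a; case: (F a) => [|x l] /=; first exact: leq_addr.
  by rewrite dsz_cons; lia.
exists (m + m'), (fun o => p o ++ p' (o + m)),
  (fun o => ECase (e' (o + m)) (e o) (EVar 0)), (fun a => T a + T' a + 2); split.
- by move=> o; rewrite size_cat mE mE'.
- by apply: PB_add (PB_const 2); apply: PB_add.
move=> o Q /[swap] a /embeds_cat []; rewrite mE => /ev /(_ a) [t tE tT].
move=> /ev' /(_ a) [t' tE' tT']; case: (F a) tE' => [|x l] tE'.
  by exists (t' + t).+1; [exact: EvalCaseNil tE' tE | lia].
exists (t' + 1).+1; last by lia.
by apply: EvalCaseCons tE' _; exact: EvalVar Q [:: _, _ & _] 0.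
Qed.

Lemma PT_nilp X `{Enc X} (F : A -> seq X) : PT F -> PT (fun a => nilp (F a)).
Proof.
move=> [sF [m [p [e [T [mE TB ev]]]]]]; split.
  by apply: (PB_le (PB_const 3)) => a; exact: dsz_bool.
exists m, p, (fun o => ECase (e o) (ECons ENil ENil) ENil), (fun a => T a + 4).
split=> //; first exact: PB_add TB (PB_const 4).
move=> o Q /[swap] a /ev /(_ a) [t tE tT]; case: (F a) tE => [|x l] tE.
  exists (t + (1 + 1).+1).+1; last by lia.
  by apply: EvalCaseNil tE _; apply: EvalCons; exact: EvalNil.
exists (t + 1).+1; last by lia.
by apply: EvalCaseCons tE _; exact: EvalNil.
Qed.

(** The bound [h] on all partial results excludes exponential growth along the list. In the
    generated block, function 0 is the loop, 1 the step and 2 the start value. *)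
Lemma PT_foldr X Y `{Enc X} `{Enc Y} (l : A -> seq X) (y0 : A -> Y)
    (f : A -> X -> Y -> Y) (h : A -> nat) :
  PB h ->
  (forall a l1 l2, l a = l1 ++ l2 -> dsz (foldr (f a) (y0 a) l2) <= h a) ->
  PT l -> PT y0 -> PT (fun axy : A * X * Y => f axy.1.1 axy.1.2 axy.2) ->
  PT (fun a => foldr (f a) (y0 a) (l a)).
Proof.
move=> hB fh [sl [m1 [p1 [e1 [T1 [mE1 TB1 ev1]]]]]].
move=> [_ [m2 [p2 [e2 [T2 [mE2 TB2 ev2]]]]]].
move=> [_ [m3 [p3 [e3 [T3 [mE3 [c [d TB3]] ev3]]]]]].
split; first by apply: (PB_le hB) => a; apply: (fh a [::]).
set w := width (A := A).
(* The loop runs in [l :: y0 :: env a]. After the case analysis, 0 is the head, 1 the tail, 3 the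
   start value, and [env a] begins at 4; the [ELet] shifts all of them by one. *)
pose body o := ECase (EVar 0) (EVar 1)
  (ELet (ECall o ([:: 1; 3] ++ iota 4 w)) (ECall o.+1 ([:: 0; 1] ++ iota 5 w))).
pose (s := fun a : A => c * (h a + (dsz (l a) + csize a)) ^ d).
have sB : PB s.
  by apply: PB_poly; apply: PB_add => //; apply: PB_add => //; exact: PB_csize.
have step_cost a l1 x l2 : l a = l1 ++ x :: l2 ->
    T3 (a, x, foldr (f a) (y0 a) l2) <= s a.
  move=> E; apply: leq_trans (TB3 _) _; rewrite leq_mul2l; apply/orP; right.
  case: (posnP d) => [->//|d0]; rewrite leq_exp2r // !csize_ext leq_add //.
    by apply: (fh a (rcons l1 x)); rewrite cat_rcons.
  rewrite leq_add2r E; pose proof (dsz_cat l1 (x :: l2)) as Hc.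
  by pose proof (dsz_gt0 l1); rewrite dsz_cons in Hc; lia.
exists (m3 + (m1 + m2)).+3,
  (fun o => [:: body o, e3 o.+3, e2 (o.+3 + m3 + m1) &
              p3 o.+3 ++ (p1 (o.+3 + m3) ++ p2 (o.+3 + m3 + m1))]),
  (fun o => ELet (e1 (o.+3 + m3)) (ELet (ECall o.+2 (iota 1 w))
    (ECall o ([:: 1; 0] ++ iota 2 w)))),
  (fun a => T1 a + T2 a + dsz (l a) * (s a + 9) + 9); split.
- by move=> o; rewrite /= !size_cat mE1 mE2 mE3.
- apply: PB_add (PB_const 9); apply: PB_add; first exact: PB_add.
  by apply: PB_mul => //; apply: PB_add => //; exact: PB_const.
move=> o Q /[swap] a /embeds_cons [E0 /embeds_cons [E1 /embeds_cons [E2]]].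
move=> /embeds_cat []; rewrite mE3 => /ev3 R3.
move=> /embeds_cat []; rewrite mE1 => /ev1 /(_ a) [t1 tE1 tT1].
move=> /ev2 /(_ a) [t2 tE2 tT2] {ev1 ev2 ev3}.
have loop l2 : forall l1, l a = l1 ++ l2 ->
  exists2 t, eval Q [:: enc l2, enc (y0 a) & env a] (body o)
               (enc (foldr (f a) (y0 a) l2)) t & t <= size l2 * (s a + 6) + 3.
  elim: l2 => [|x l2 IH] l1 lE.
    by exists (1 + 1).+1 => //; apply: EvalCaseNil; exact: EvalVar.
  have [t tE tT] := IH (rcons l1 x) (etrans lE (esym (cat_rcons _ _ _))).
  have [t3 tE3 tT3] := R3 (a, x, foldr (f a) (y0 a) l2).
  exists (1 + (t.+1 + t3.+1).+1).+1; last first.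
    by have := step_cost _ _ _ _ lE; rewrite /= mulSn; lia.
  apply: EvalCaseCons; first exact: EvalVar.
  apply: (EvalLet (v1 := enc (foldr (f a) (y0 a) l2))).
    apply: EvalCall; rewrite E0 map_cat /w -(size_env a).
    by rewrite (env_iota [:: _; _; _; _] (env a)).
  apply: EvalCall; rewrite E1 map_cat /w -(size_env a).
  by rewrite (env_iota [:: _; _; _; _; _] (env a)).
have [t tE tT] := loop (l a) [::] erefl.
exists (t1 + (t2.+1 + t.+1).+1).+1.
  apply: EvalLet tE1 _; apply: (EvalLet (v1 := enc (y0 a))).
    apply: EvalCall; rewrite E2 /w -(size_env a).
    by rewrite (env_iota [:: _] (env a)).
  apply: EvalCall; rewrite E0 map_cat /w -(size_env a).
  by rewrite (env_iota [:: _; _] (env a)).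
have : size (l a) * (s a + 6) <= dsz (l a) * (s a + 9).
  by rewrite leq_mul ?leq_add2l // ltnW // size_dsz.
lia.
Qed.

End Rules.

Section BooleanRules.
Context {A : Type} `{CA : Ctx A}.

Lemma PT_filter X `{Enc X} (p : A -> X -> bool) (l : A -> seq X) :
  PT (fun ax : A * X => p ax.1 ax.2) -> PT l -> PT (fun a => filter (p a) (l a)).
Proof.
move=> pp pl.
apply: (PT_ext (F := fun a => foldr (fun x y => if p a x then x :: y else y) [::] (l a))).
  by move=> a; elim: (l a) => //= x s ->.
apply: (@PT_foldr _ _ _ _ _ _ l (fun=> [::])
  (fun a x y => if p a x then x :: y else y) (fun a => dsz (l a))) => //.
- by case: pl.
- move=> a l1 l2 ->; elim: l1 => [|x l1 IH] /=; last by rewrite dsz_cons; lia.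
  elim: l2 => //= x l2 IH; rewrite [dsz (x :: l2)]dsz_cons.
  by case: ifP; rewrite ?dsz_cons; lia.
- exact: PT_nil.
apply: PT_if; first exact: (PT_fst pp).
  by apply: PT_cons; [exact: (PT_fst PT_snd) | exact: PT_snd].
exact: PT_snd.
Qed.

Lemma PT_not (b : A -> bool) : PT b -> PT (fun a => ~~ b a).
Proof.
move=> pb; apply: (PT_ext (F := fun a => if b a then false else true)).
  by move=> a; case: (b a).
by apply: PT_if => //; [exact: PT_false | exact: PT_true].
Qed.

Lemma PT_and (b c : A -> bool) : PT b -> PT c -> PT (fun a => b a && c a).
Proof. by move=> pb pc; apply: PT_if => //; exact: PT_false. Qed.

End BooleanRules.

Section DerivedRules.
Context {A : Type} `{CA : Ctx A}.

Lemma PT_has X `{Enc X} (p : A -> X -> bool) (l : A -> seq X) :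
  PT (fun ax : A * X => p ax.1 ax.2) -> PT l -> PT (fun a => has (p a) (l a)).
Proof.
move=> pp pl; apply: (PT_ext (F := fun a => ~~ nilp (filter (p a) (l a)))).
  by move=> a; rewrite /nilp size_filter has_count lt0n.
by apply: PT_not; apply: PT_nilp; exact: PT_filter.
Qed.

Lemma PT_all X `{Enc X} (p : A -> X -> bool) (l : A -> seq X) :
  PT (fun ax : A * X => p ax.1 ax.2) -> PT l -> PT (fun a => all (p a) (l a)).
Proof.
move=> pp pl; apply: (PT_ext (F := fun a => ~~ has (fun x => ~~ p a x) (l a))).
  by move=> a; rewrite -all_predC; apply: eq_all => x /=; rewrite negbK.
by apply: PT_not; apply: (@PT_has _ _ (fun a x => ~~ p a x)) => //; exact: (PT_not pp).
Qed.

(** Each image is polynomial in its element, and no element is larger than the list; this yields the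
    bound on partial results that [PT_foldr] asks for. *)
Lemma PT_map X Y `{Enc X} `{Enc Y} (f : A -> X -> Y) (l : A -> seq X) :
  PT (fun ax : A * X => f ax.1 ax.2) -> PT l -> PT (fun a => map (f a) (l a)).
Proof.
move=> pf pl; have [[c [d fB]] _] := pf; have [lB _] := pl.
pose (m := fun a => c * (dsz (l a) + csize a) ^ d).
pose (h := fun a => dsz (l a) * (m a + 1) + 1).
have hB : PB h.
  apply: PB_add (PB_const 1); apply: PB_mul => //; apply: PB_add (PB_const 1).
  by apply: PB_poly; apply: PB_add PB_csize.
apply: (@PT_foldr _ _ _ _ _ _ l (fun=> [::]) (fun a x y => f a x :: y) h) => //.
- move=> a l1 l2 lE.
  have xm x : forall l3 l4, l2 = l3 ++ x :: l4 -> dsz (f a x) <= m a.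
    move=> l3 l4 E; apply: leq_trans (fB (a, x)) _; rewrite leq_mul2l csize_ext.
    apply/orP; right; case: (posnP d) => [->//|d0]; rewrite leq_exp2r //.
    rewrite leq_add2r lE E catA; pose proof (dsz_cat (l1 ++ l3) (x :: l4)) as Hc.
    by pose proof (dsz_gt0 (l1 ++ l3)); rewrite dsz_cons in Hc; lia.
  have : size l2 <= dsz (l a).
    by pose proof (size_dsz (l a)) as Hs; rewrite lE size_cat in Hs *; lia.
  enough (H1 : dsz (foldr (fun x y => f a x :: y) [::] l2) <= size l2 * (m a + 1) + 1).
    rewrite /h /= => H2; apply: (leq_trans H1).
    by rewrite leq_add2r leq_mul2r H2 orbT.
  elim: l2 {lE} xm => [|x l2 IH] xm //=; rewrite dsz_cons mulSn.
  have := IH (fun y l3 l4 E => xm y (x :: l3) l4 (congr1 _ E)).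
  by have := xm x [::] l2 erefl; lia.
- exact: PT_nil.
by apply: PT_cons; [exact: (PT_fst pf) | exact: PT_snd].
Qed.

Lemma PT_cat X `{Enc X} (l1 l2 : A -> seq X) :
  PT l1 -> PT l2 -> PT (fun a => l1 a ++ l2 a).
Proof.
move=> p1 p2; have [B1 _] := p1; have [B2 _] := p2.
apply: (PT_ext (F := fun a => foldr cons (l2 a) (l1 a))).
  by move=> a; elim: (l1 a) => //= x s ->.
apply: (@PT_foldr _ _ _ _ _ _ l1 l2 (fun _ => cons) (fun a => dsz (l1 a) + dsz (l2 a))) => //.
- exact: PB_add.
- move=> a s s' ->; elim: s => [|x s IH] /=; last by rewrite dsz_cons; lia.
  by elim: s' => [|x s' IH] /=; rewrite ?dsz_cons; lia.
by apply: PT_cons; [exact: (PT_fst PT_snd) | exact: PT_snd].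
Qed.

(** A number is encoded like a list of units, so the loop is a fold along [nseq (n a) tt]; [drop]
    carries the bounds over to the context with the extra unit variable. *)
Lemma PT_iter Y `{Enc Y} (n : A -> nat) (f : A -> Y -> Y) (y0 : A -> Y) (h : A -> nat) :
  PB h -> (forall a i, i <= n a -> dsz (iter i (f a) (y0 a)) <= h a) ->
  PT n -> PT y0 -> PT (fun ay : A * Y => f ay.1 ay.2) ->
  PT (fun a => iter (n a) (f a) (y0 a)).
Proof.
move=> hB fh pn py [sf [m [p [e [T [mE TB ev]]]]]].
have foldrE a (s : seq unit) : foldr (fun _ => f a) (y0 a) s = iter (size s) (f a) (y0 a).
  by elim: s => //= _ s ->.
apply: (PT_ext (F := fun a => foldr (fun _ => f a) (y0 a) (nseq (n a) tt))).
  by move=> a; rewrite foldrE size_nseq.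
apply: (@PT_foldr _ _ _ _ _ _ (fun a => nseq (n a) tt) y0 (fun a _ => f a) h) => //.
- move=> a l1 l2 E; rewrite foldrE; apply: fh.
  by have := congr1 size E; rewrite size_nseq size_cat; lia.
- by apply: PT_enc pn => a; elim: (n a) => // i IH; rewrite -[LHS]/(Cons Nil (enc i)) IH.
have drop (F : A * Y -> nat) : PB F -> PB (fun axy : A * unit * Y => F (axy.1.1, axy.2)).
  move=> [c [d FB]]; exists c, d => -[[a []] y] /=; rewrite !csize_ext.
  apply: leq_trans (FB _) _; rewrite leq_mul2l csize_ext; apply/orP; right.
  by case: (posnP d) => [->//|d0]; rewrite leq_exp2r // leq_add2l leq_addl.
split; first exact: drop sf.
exists m.+1, (fun o => e o.+1 :: p o.+1),
  (fun o => ECall o (0 :: iota 2 (width (A := A)))), (fun ay => 1 + T (ay.1.1, ay.2)).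
split; [by move=> o /=; rewrite mE | exact: PB_add (PB_const 1) (drop _ TB) |].
move=> o Q /embeds_cons [oE /ev evQ] [[a []] y]; have [t tE tT] := evQ (a, y).
exists t.+1 => //; apply: EvalCall; rewrite oE -(size_env a) map_cons.
by rewrite (env_iota [:: enc y; enc tt] (env a)).
Qed.

Lemma PT_size X `{Enc X} (l : A -> seq X) : PT l -> PT (fun a => size (l a)).
Proof.
move=> pl; have [lB _] := pl.
apply: (PT_ext (F := fun a => foldr (fun _ : X => S) 0 (l a))).
  by move=> a; elim: (l a) => //= x s ->.
apply: (@PT_foldr _ _ _ _ _ _ l (fun=> 0) (fun _ _ => S)
          (fun a => dsz (l a) + dsz (l a))) => //.
- exact: PB_add.
- move=> a l1 l2 E; rewrite dsz_nat.
  have : size l2 < dsz (l a).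
    by rewrite E; apply: leq_ltn_trans (size_dsz _); rewrite size_cat leq_addl.
  suff -> : foldr (fun _ : X => S) 0 l2 = size l2 by lia.
  by elim: l2 {E} => //= x s ->.
- exact: PT_0.
by apply: PT_S; exact: PT_snd.
Qed.

Lemma PT_add (m n : A -> nat) : PT m -> PT n -> PT (fun a => m a + n a).
Proof.
move=> pm pn; have [mB _] := pm; have [nB _] := pn.
apply: (PT_ext (F := fun a => iter (m a) S (n a))).
  by move=> a; elim: (m a) => //= i ->.
apply: (@PT_iter _ _ m (fun=> S) n (fun a => dsz (m a) + dsz (n a))) => //.
- exact: PB_add.
- by move=> a i im; rewrite iter_succn !dsz_nat; lia.
by apply: PT_S; exact: PT_snd.
Qed.

Lemma PT_sub (m n : A -> nat) : PT m -> PT n -> PT (fun a => m a - n a).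
Proof.
move=> pm pn; have [mB _] := pm.
apply: (PT_ext (F := fun a => iter (n a) predn (m a))).
  by move=> a; elim: (n a) => [|i IH]; [rewrite subn0 | rewrite iterS IH subnS].
apply: (@PT_iter _ _ n (fun=> predn) m (fun a => dsz (m a))) => //.
  move=> a i _; rewrite !dsz_nat; suff : iter i predn (m a) <= m a by lia.
  by elim: i => //= i IH; lia.
by apply: PT_pred; exact: PT_snd.
Qed.

Lemma PT_leq (m n : A -> nat) : PT m -> PT n -> PT (fun a => m a <= n a).
Proof.
move=> pm pn; apply: (PT_ext (F := fun a => nilp (nseq (m a - n a) tt))).
  by move=> a; rewrite /nilp size_nseq.
apply: PT_nilp; apply: PT_enc (PT_sub pm pn) => a.
by elim: (m a - n a) => // i IH; rewrite -[LHS]/(Cons Nil (enc i)) IH.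
Qed.

Lemma PT_eqn (m n : A -> nat) : PT m -> PT n -> PT (fun a => m a == n a).
Proof.
move=> pm pn; apply: (PT_ext (F := fun a => (m a <= n a) && (n a <= m a))).
  by move=> a; rewrite eqn_leq.
by apply: PT_and; exact: PT_leq.
Qed.

Lemma PT_nth X `{Enc X} (x0 : A -> X) (l : A -> seq X) (n : A -> nat) :
  PT x0 -> PT l -> PT n -> PT (fun a => nth (x0 a) (l a) (n a)).
Proof.
move=> px pl pn; have [lB _] := pl.
have iterE (i : nat) (s : seq X) : iter i behead s = drop i s.
  by elim: i s => [|i IH] [|x s] //; rewrite iterSr /= IH.
apply: (PT_ext (F := fun a => head (x0 a) (iter (n a) behead (l a)))).
  by move=> a; rewrite iterE -nth0 nth_drop addn0.
apply: PT_head => //.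
apply: (@PT_iter _ _ n (fun=> behead) l (fun a => dsz (l a))) => //.
  move=> a i _; rewrite iterE; elim: i (l a) => [|i IH] [|x s] //=.
  by rewrite dsz_cons; apply: leq_trans (IH s) _; lia.
by apply: PT_behead; exact: PT_snd.
Qed.

End DerivedRules.

Lemma PT_mem A `{Ctx A} (n : A -> nat) (l : A -> seq nat) :
  PT n -> PT l -> PT (fun a => n a \in l a).
Proof.
move=> pn pl; apply: (PT_ext (F := fun a => has (fun x => n a == x) (l a))).
  by move=> a; rewrite -has_pred1; apply: eq_has => x /=; rewrite eq_sym.
apply: (@PT_has _ _ _ _ (fun a x => n a == x)) => //.
by apply: PT_eqn; [exact: PT_fst | exact: PT_snd].
Qed.

Lemma dsz_flatten X `{Enc X} (ll : seq (seq X)) : dsz (flatten ll) <= dsz ll.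
Proof.
elim: ll => //= l ll IH; rewrite [dsz (_ :: _)]dsz_cons.
by pose proof (dsz_cat l (flatten ll)); lia.
Qed.

Lemma dsz_catr X `{Enc X} (l1 l2 : seq X) : dsz l2 <= dsz (l1 ++ l2).
Proof. by pose proof (dsz_cat l1 l2); pose proof (dsz_gt0 l1); lia. Qed.

Lemma PT_flatten A `{Ctx A} X `{Enc X} (ll : A -> seq (seq X)) :
  PT ll -> PT (fun a => flatten (ll a)).
Proof.
move=> pl; have [lB _] := pl.
apply: (@PT_foldr _ _ _ _ _ _ ll (fun=> [::]) (fun _ => cat) (fun a => dsz (ll a))) => //.
- move=> a l1 l2 ->; apply: leq_trans (dsz_catr l1 l2).
  exact: dsz_flatten.
- exact: PT_nil.
by apply: PT_cat; [exact: (PT_fst PT_snd) | exact: PT_snd].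
Qed.

(** * The algorithm *)

Definition edge (M : seq (seq bool)) (x y : nat) : bool := nth false (nth [::] M x) y.

(** The row indices in decreasing order; the length of the list built so far serves as the counter,
    which makes this a plain fold. *)
Definition vertices (M : seq (seq bool)) : seq nat :=
  foldr (fun _ vs => size vs :: vs) [::] M.

(* An entry ((prev, cur), (cost, strat)) describes one run of the process:
   [cur] lists the vertices burned last, [prev] those burned just before (to
   tell the parents of the vertices in [cur] from their children), [cost] counts
   the burned targets. *)
Definition entry : Type := (seq nat * seq nat) * (nat * seq (nat * nat)).

(** Neighbours of the front are parents or children of its vertices, and the parents were burned
    just before; the children remain. *)
Definition candidates M (e : entry) : seq nat :=
  [seq v <- vertices M | has (fun u => edge M v u) e.1.2 && (v \notin e.1.1)].

(** Members of [C] that are not candidates are ignored, so every list is a legitimate choice. *)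
Definition advance M (S : seq bool) (t : nat) (e : entry) (C : seq nat) : entry :=
  let new := [seq v <- candidates M e | v \notin C] in
  ((e.1.2, new),
   (e.2.1 + size [seq v <- new | nth false S v],
    [seq (v, t) | v <- [seq v <- candidates M e | v \in C]] ++ e.2.2)).

(** The length is exactly [b] and repetitions are allowed; smaller sets of protections appear
    padded. *)
Fixpoint lists_of (T : Type) (vs : seq T) (b : nat) : seq (seq T) :=
  if b is b'.+1 then flatten [seq [seq v :: C | C <- lists_of vs b'] | v <- vs]
  else [:: [::]].

Definition eq_members (l1 l2 : seq nat) :=
  all (fun x => x \in l2) l1 && all (fun x => x \in l1) l2.

Definition same_key (e1 e2 : entry) :=
  eq_members e1.1.1 e2.1.1 && eq_members e1.1.2 e2.1.2.

Definition insert (e : entry) (L : seq entry) : seq entry :=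
  if has (fun e' => same_key e e' && (e'.2.1 <= e.2.1)) L then L
  else e :: [seq e' <- L | ~~ same_key e e'].

Definition round (b : nat) M S (st : nat * seq entry) : nat * seq entry :=
  (st.1.+1,
   foldr insert [::]
     (flatten [seq [seq advance M S st.1 e C | C <- lists_of (vertices M) b] | e <- st.2])).

Definition initial (s : nat) (S : seq bool) : entry :=
  (([::], [:: s]), (size [seq v <- [:: s] | nth false S v], [::])).

Definition rounds b M s S (t : nat) : nat * seq entry :=
  iter t (round b M S) (1, [:: initial s S]).

(** On a rooted tree, both lists of every key are empty after [size M + 1] rounds, so exactly one
    entry is left and [head] does not return its default. *)
Definition solve b M s S : seq (nat * nat) :=
  (head (initial s S) (rounds b M s S (size M).+1).2).2.2.

(** * Cost of the components of the algorithm *)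

Section Components.
Context {A : Type} `{CA : Ctx A}.

Lemma PT_edge (M : A -> seq (seq bool)) (x y : A -> nat) :
  PT M -> PT x -> PT y -> PT (fun a => edge (M a) (x a) (y a)).
Proof.
move=> pM px py; apply: PT_nth => //; first exact: PT_false.
by apply: PT_nth => //; exact: PT_nil.
Qed.

Lemma vertices_cons r M : vertices (r :: M) = size M :: vertices M.
Proof.
have sz (N : seq (seq bool)) : size (vertices N) = size N by elim: N => //= ? ? ->.
by rewrite -{1}(sz M).
Qed.

Lemma mem_vertices M x : (x \in vertices M) = (x < size M).
Proof.
by elim: M => // r M IH; rewrite vertices_cons inE IH /= ltnS [RHS]leq_eqVlt.
Qed.

Lemma size_vertices M : size (vertices M) = size M.
Proof. by elim: M => //= r M ->. Qed.

Lemma dsz_vertices M : dsz (vertices M) <= (dsz M) * (dsz M).*2 + 1.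
Proof.
apply: leq_trans (dsz_seq_le (m := (size M).*2) _) _.
  move=> l1 x l2 E; rewrite dsz_nat; have : x \in vertices M.
    by rewrite E mem_cat mem_head orbT.
  by rewrite mem_vertices; lia.
rewrite size_vertices leq_add2r; pose proof (size_dsz M).
by rewrite leq_mul //; lia.
Qed.

Lemma PT_vertices (M : A -> seq (seq bool)) : PT M -> PT (fun a => vertices (M a)).
Proof.
move=> pM; have [MB _] := pM.
apply: (@PT_foldr _ _ _ _ _ _ M (fun=> [::]) (fun _ _ vs => size vs :: vs)
          (fun a => dsz (M a) * (dsz (M a) + dsz (M a)) + 1)) => //.
- by apply: PB_add (PB_const 1); apply: PB_mul => //; apply: PB_add.
- move=> a l1 l2 E; apply: leq_trans (dsz_vertices l2) _.
  have : dsz l2 <= dsz (M a) by rewrite E dsz_catr.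
  by move=> h; rewrite leq_add2r leq_mul // addnn leq_double.
- exact: PT_nil.
by apply: PT_cons; [apply: PT_size | ]; exact: PT_snd.
Qed.

End Components.

Section Steps.
Context {A : Type} `{CA : Ctx A}.

Lemma PT_candidates M (e : A -> entry) : PT M -> PT e ->
  PT (fun a => candidates (M a) (e a)).
Proof.
move=> pM pe; apply: (@PT_filter _ _ _ _
  (fun a v => has (fun u => edge (M a) v u) (e a).1.2 && (v \notin (e a).1.1)));
  last exact: PT_vertices.
apply: PT_and; last first.
  by apply: PT_not; apply: PT_mem; [exact: PT_snd | apply: PT_1; apply: PT_1; exact: (PT_fst pe)].
apply: (@PT_has _ _ _ _ (fun (av : A * nat) u => edge (M av.1) av.2 u)).
  by apply: PT_edge; [exact: (PT_fst (PT_fst pM)) | exact: (PT_fst PT_snd) | exact: PT_snd].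
by apply: PT_2; apply: PT_1; exact: (PT_fst pe).
Qed.

Lemma PT_advance M S t (e : A -> entry) C :
  PT M -> PT S -> PT t -> PT e -> PT C ->
  PT (fun a => advance (M a) (S a) (t a) (e a) (C a)).
Proof.
move=> pM pS pt pe pC.
have pnew : PT (fun a => [seq v <- candidates (M a) (e a) | v \notin C a]).
  apply: (@PT_filter _ _ _ _ (fun a v => v \notin C a)); last exact: PT_candidates.
  by apply: PT_not; apply: PT_mem; [exact: PT_snd | exact: (PT_fst pC)].
apply: PT_pair; first by apply: PT_pair => //; apply: PT_2; exact: PT_1.
apply: PT_pair.
  apply: PT_add; first by apply: PT_1; exact: PT_2.
  apply: PT_size; apply: (@PT_filter _ _ _ _ (fun a v => nth false (S a) v)) => //.
  by apply: PT_nth; [exact: PT_false | exact: (PT_fst pS) | exact: PT_snd].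
apply: PT_cat; last by apply: PT_2; exact: PT_2.
apply: (@PT_map _ _ _ _ _ _ (fun a v => (v, t a))).
  by apply: PT_pair; [exact: PT_snd | exact: (PT_fst pt)].
apply: (@PT_filter _ _ _ _ (fun a v => v \in C a)); last exact: PT_candidates.
by apply: PT_mem; [exact: PT_snd | exact: (PT_fst pC)].
Qed.

Lemma PT_eq_members (l1 l2 : A -> seq nat) : PT l1 -> PT l2 ->
  PT (fun a => eq_members (l1 a) (l2 a)).
Proof.
move=> p1 p2; apply: PT_and.
  apply: (@PT_all _ _ _ _ (fun a x => x \in l2 a)) => //.
  by apply: PT_mem; [exact: PT_snd | exact: (PT_fst p2)].
apply: (@PT_all _ _ _ _ (fun a x => x \in l1 a)) => //.
by apply: PT_mem; [exact: PT_snd | exact: (PT_fst p1)].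
Qed.

Lemma PT_same_key (e1 e2 : A -> entry) : PT e1 -> PT e2 ->
  PT (fun a => same_key (e1 a) (e2 a)).
Proof.
by move=> p1 p2; apply: PT_and; apply: PT_eq_members;
  first [apply: PT_1; exact: PT_1 | apply: PT_2; exact: PT_1].
Qed.

End Steps.

Lemma PT_lists_of A `{Ctx A} X `{Enc X} (vs : A -> seq X) b :
  PT vs -> PT (fun a => lists_of (vs a) b).
Proof.
move=> pv; elim: b => [|b IH] /=; first by apply: PT_cons; exact: PT_nil.
apply: PT_flatten.
apply: (@PT_map _ _ _ _ _ _ (fun a v => [seq v :: C | C <- lists_of (vs a) b])) => //.
apply: (@PT_map _ _ _ _ _ _ (fun (av : A * X) C => av.2 :: C)); last exact: (PT_fst IH).
by apply: PT_cons; [exact: (PT_fst PT_snd) | exact: PT_snd].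
Qed.

Lemma dsz_filter X `{Enc X} (p : pred X) l : dsz (filter p l) <= dsz l.
Proof.
by elim: l => //= x l IH; case: ifP => _; rewrite ?dsz_cons /=; lia.
Qed.

Lemma dsz_insert e L : dsz (insert e L) <= dsz (e :: L).
Proof.
rewrite /insert; case: ifP => _; first by rewrite dsz_cons; lia.
by rewrite !dsz_cons; pose proof (dsz_filter (fun e' => ~~ same_key e e') L); lia.
Qed.

Lemma dsz_prune L : dsz (foldr insert [::] L) <= dsz L.
Proof.
elim: L => //= e L IH; apply: leq_trans (dsz_insert _ _) _.
by rewrite !dsz_cons; lia.
Qed.

Lemma PT_insert A `{Ctx A} (e : A -> entry) (L : A -> seq entry) :
  PT e -> PT L -> PT (fun a => insert (e a) (L a)).
Proof.
move=> pe pL; have pk : PT (fun ax : A * entry => same_key (e ax.1) ax.2).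
  by apply: PT_same_key; [exact: (PT_fst pe) | exact: PT_snd].
apply: PT_if => //.
  apply: (@PT_has _ _ _ _ (fun a e' => same_key (e a) e' && (e'.2.1 <= (e a).2.1))) => //.
  apply: PT_and => //; apply: PT_leq; apply: PT_1; apply: PT_2; first exact: PT_snd.
  exact: (PT_fst pe).
apply: PT_cons => //; apply: (@PT_filter _ _ _ _ (fun a e' => ~~ same_key (e a) e')) => //.
exact: PT_not pk.
Qed.

Lemma PT_prune A `{Ctx A} (L : A -> seq entry) :
  PT L -> PT (fun a => foldr insert [::] (L a)).
Proof.
move=> pL; have [LB _] := pL.
apply: (@PT_foldr _ _ _ _ _ _ L (fun=> [::]) (fun _ => insert) (fun a => dsz (L a))) => //.
- by move=> a l1 l2 ->; apply: leq_trans (dsz_prune _) (dsz_catr _ _).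
- exact: PT_nil.
by apply: PT_insert; [exact: (PT_fst PT_snd) | exact: PT_snd].
Qed.

Lemma PT_round A `{Ctx A} b M S (st : A -> nat * seq entry) :
  PT M -> PT S -> PT st -> PT (fun a => round b (M a) (S a) (st a)).
Proof.
move=> pM pS pst; apply: PT_pair; first by apply: PT_S; exact: PT_1.
apply: PT_prune; apply: PT_flatten.
apply: (@PT_map _ _ _ _ _ _ (fun a e =>
  [seq advance (M a) (S a) (st a).1 e C | C <- lists_of (vertices (M a)) b]));
  last exact: PT_2.
apply: (@PT_map _ _ _ _ _ _ (fun (ae : A * entry) C => advance (M ae.1) (S ae.1) (st ae.1).1 ae.2 C)).
  by apply: PT_advance; [exact: (PT_fst (PT_fst pM)) | exact: (PT_fst (PT_fst pS))
    | exact: (PT_fst (PT_fst (PT_1 pst))) | exact: (PT_fst PT_snd) | exact: PT_snd].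
apply: PT_lists_of; apply: PT_vertices; exact: (PT_fst pM).
Qed.

Lemma PT_initial A `{Ctx A} (s : A -> nat) S : PT s -> PT S ->
  PT (fun a => initial (s a) (S a)).
Proof.
move=> ps pS; have p1 : PT (fun a => [:: s a]) by apply: PT_cons => //; exact: PT_nil.
apply: PT_pair; apply: PT_pair => //; try exact: PT_nil.
apply: PT_size; apply: (@PT_filter _ _ _ _ (fun a v => nth false (S a) v)) => //.
by apply: PT_nth; [exact: PT_false | exact: (PT_fst pS) | exact: PT_snd].
Qed.

(** The size of the states is controlled by the graph class and not by the program text, so its
    bound is a hypothesis here; [dsz_rounds] supplies it. *)
Lemma PT_solve A `{Ctx A} b M (s : A -> nat) S (h : A -> nat) :
  PB h -> (forall a t, t <= (size (M a)).+1 -> dsz (rounds b (M a) (s a) (S a) t) <= h a) ->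
  PT M -> PT s -> PT S -> PT (fun a => solve b (M a) (s a) (S a)).
Proof.
move=> hB hst pM ps pS; have pi := PT_initial ps pS.
apply: PT_2; apply: PT_2; apply: PT_head => //; apply: PT_2.
apply: (@PT_iter _ _ _ _ (fun a => (size (M a)).+1) (fun a => round b (M a) (S a))
          (fun a => (1, [:: initial (s a) (S a)])) h) => //.
- by apply: PT_S; exact: PT_size.
- apply: PT_pair; first by apply: PT_S; exact: PT_0.
  by apply: PT_cons => //; exact: PT_nil.
by apply: PT_round; [exact: (PT_fst pM) | exact: (PT_fst pS) | exact: PT_snd].
Qed.

Lemma polytime_of_PT (I : Type) (inp : I -> data) (dom : I -> Prop)
    (sol : I -> data -> Prop) X `{Enc X} (F : {i | dom i} -> X)
    (C := {| env := fun i : {i | dom i} => [:: inp (sval i)];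
             size_env := fun _ => erefl 1 |} : Ctx {i | dom i}) :
  PT F -> (forall i (di : dom i), sol i (enc (F (exist _ i di)))) ->
  polytime_solvable inp dom sol.
Proof.
move=> [_ [m [p [e [T [mE [c [d TB]] ev]]]]]] Fsol.
(* Function 0 is the main expression, so the auxiliary functions are loaded from index 1. The factor
   [2 ^ d] absorbs the successor in [csize]. *)
exists (e 1 :: p 1), (c * 2 ^ d), d => i di.
have [|t tE tT] := ev 1 (e 1 :: p 1) _ (exist _ i di); first by move=> j jp; rewrite add1n.
exists (enc (F (exist _ i di))), t; split=> //.
apply: leq_trans tT (leq_trans (TB _) _); rewrite -mulnA leq_mul2l -expnMn.
apply/orP; right; case: (posnP d) => [->//|d0]; rewrite leq_exp2r // /csize /= addn0.
by case: (inp i) => [|? ?] /=; lia.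
Qed.

(** * Strategies on rooted trees *)

(** As levels drop along [par], every vertex reaches [s], and the edges are exactly the parent
    pairs: the record carries both connectedness and acyclicity. With [par s = s], iterating [par]
    past the root is harmless. *)
Record rooted (V : finType) (e : rel V) (s : V) (par : V -> V) (lv : V -> nat) : Prop :=
  Rooted {
    lv_root : lv s = 0;
    par_root : par s = s;
    lv_par : forall v, v != s -> lv v = (lv (par v)).+1;
    rooted_edge : forall x y,
      e x y = (y != s) && (x == par y) || (x != s) && (y == par x) }.

Section Rooted.
Variables (V : finType) (e : rel V) (s : V) (par : V -> V) (lv : V -> nat).
Hypothesis R : rooted e s par lv.
Implicit Type A : {set V}.

Lemma lv0_root v : lv v = 0 -> v = s.
Proof. by move=> v0; apply/eqP/negPn/negP => /(lv_par R); rewrite v0. Qed.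

Lemma lv_iter_par i v : lv (iter i par v) = lv v - i.
Proof.
elim: i => [|i IH]; first by rewrite subn0.
rewrite iterS; case: (eqVneq (iter i par v) s) => [E|ne].
  by rewrite E (par_root R) (lv_root R); move: IH; rewrite E (lv_root R); lia.
by have := lv_par R ne; rewrite IH; lia.
Qed.

Definition anc u v := (lv u <= lv v) && (iter (lv v - lv u) par v == u).

Lemma iter_anc i v : anc (iter i par v) v.
Proof.
rewrite /anc lv_iter_par leq_subr /=; case: (leqP i (lv v)) => [le|/ltnW le].
  by rewrite subKn.
apply/eqP; have -> : iter i par v = s by apply: lv0_root; rewrite lv_iter_par; lia.
by apply: lv0_root; rewrite lv_iter_par; lia.
Qed.

Lemma ancP u v : reflect (exists i, iter i par v = u) (anc u v).
Proof.
apply: (iffP idP) => [/andP[_ /eqP E]|[i <-]]; last exact: iter_anc.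
by exists (lv v - lv u).
Qed.

Lemma anc_refl v : anc v v. Proof. exact: (iter_anc 0). Qed.

Lemma anc_par v : anc (par v) v. Proof. exact: (iter_anc 1). Qed.

Lemma anc_trans : transitive anc.
Proof. by move=> v u w /ancP[i <-] /ancP[j <-]; rewrite -iterD iter_anc. Qed.

Lemma anc_lv u v : anc u v -> lv u <= lv v.
Proof. by case/andP. Qed.

Lemma anc_parE u v : v != s -> anc u v = (u == v) || anc u (par v).
Proof.
move=> vs; apply/ancP/orP => [[[|i] E]|[/eqP ->|/ancP[i <-]]].
- by left; rewrite -E.
- by right; apply/ancP; exists i; rewrite -iterSr.
- by exists 0.
by exists i.+1; rewrite iterSr.
Qed.

Lemma anc_root u : anc u s = (u == s).
Proof.
apply/idP/eqP => [/anc_lv|->]; last exact: anc_refl.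
by rewrite (lv_root R) leqn0 => /eqP /lv0_root.
Qed.

Lemma anc_chain u w v : anc u v -> anc w v -> lv u <= lv w -> anc u w.
Proof.
move=> /andP[uv /eqP uE] /andP[wv /eqP wE] uw; apply/ancP.
by exists (lv w - lv u); rewrite -{2}wE -iterD -{}[RHS]uE; congr iter; lia.
Qed.

Lemma anc_at u v : lv u = lv v -> anc u v = (u == v).
Proof. by move=> E; rewrite /anc E leqnn subnn eq_sym. Qed.

(** The ancestors of [v] have pairwise distinct levels, which gives [lv v + 1] different
    vertices. *)
Lemma lv_lt_card v : lv v < #|V|.
Proof.
have inj : injective (fun i : 'I_(lv v).+1 => iter i par v).
  move=> i j /(congr1 lv); rewrite !lv_iter_par => E; apply: val_inj => /=.
  by have := ltn_ord i; have := ltn_ord j; lia.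
by have := leq_card _ inj; rewrite card_ord.
Qed.

Definition free (A : {set V}) v := [forall u in A, ~~ anc u v].

Lemma free_root A : s \notin A -> free A s.
Proof.
move=> sA; apply/forall_inP => u uA; rewrite anc_root.
by apply: contraNneq sA => <-.
Qed.

Lemma free_par A v : v != s -> free A v = (v \notin A) && free A (par v).
Proof.
move=> vs; apply/forall_inP/andP => [H|[vA /forall_inP H] u uA].
  split; first by apply/negP => /H; rewrite anc_refl.
  by apply/forall_inP => u /H; rewrite anc_parE // negb_or => /andP[].
rewrite anc_parE // negb_or H // andbT.
by apply: contraNneq vA => <-.
Qed.

Lemma free_anc A u v : anc u v -> free A v -> free A u.
Proof.
move=> uv /forall_inP H; apply/forall_inP => w /H; apply: contra => wu.
exact: anc_trans wu uv.
Qed.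

Definition admissible b (A : {set V}) :=
  s \notin A /\ forall i, #|[set v in A | lv v == i]| <= b.

(** Time [lv v] is the last moment for protecting [v], which is burned at time [lv v + 1] unless it
    is cut off. *)
Definition level_strategy (A : {set V}) : strategy V :=
  [set vt : V * 'I_#|V|.+1 | (vt.1 \in A) && (vt.2 == lv vt.1 :> nat)].

Lemma level_protected A t :
  protected_at (level_strategy A) t = [set v in A | lv v <= t].
Proof.
apply/setP => v; rewrite !inE; apply/existsP/andP => [[u]|[vA vt]].
  by rewrite inE /= => /and3P[ut -> /eqP <-].
exists (inord (lv v)); rewrite inE /= vA inordK ?vt ?eqxx //.
by rewrite ltnS ltnW // lv_lt_card.
Qed.

(** Only [s] is burned at time 1, hence the strict inequality on levels. The fire may also cross an
    edge from child to parent, but this adds nothing: ancestors of free vertices are free and have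
    smaller level. *)
Lemma level_burned A t : s \notin A -> 0 < t ->
  burned_at e s (level_strategy A) t = [set v | (lv v < t) && free A v].
Proof.
move=> sA; case: t => // t _; elim: t => [|t IH].
  apply/setP => v; rewrite !inE ltnS leqn0; apply/eqP/andP => [->|[/eqP /lv0_root//]].
  by rewrite (lv_root R) free_root.
rewrite (burned_atS _ _ _ (ltn0Sn t)) IH level_protected.
apply/setP => v; rewrite !inE.
have [->|vs] := eqVneq v s; first by rewrite (lv_root R) /= free_root.
rewrite (free_par A vs) (lv_par R vs) !ltnS.
apply/orP/and3P => [[/andP[lt /andP[vA fr]]|]|[lt vA fr]].
- by split=> //; apply: ltnW.
- rewrite negb_and -ltnNge => /andP[H /exists_inP[u]]; rewrite inE => /andP[ut fu].
  rewrite (rooted_edge R) vs => /orP[/= /eqP E|/andP[us /eqP E]].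
    by split; rewrite -?E //; move: H; rewrite -E; case/orP=> //; lia.
  have [fv lvu] : free A v /\ lv u = (lv v).+1.
    by rewrite E; split; [exact: free_anc (anc_par u) fu | exact: (lv_par R)].
  move: fv; rewrite (free_par A vs) => /andP[-> ->]; split=> //.
  by have := lv_par R vs; lia.
right; rewrite negb_and vA /=; apply/exists_inP; exists (par v).
  by rewrite inE ltnS lt fr.
by rewrite (rooted_edge R) vs eqxx.
Qed.

Lemma level_burned_all A : s \notin A ->
  burned e s (level_strategy A) = [set v | free A v].
Proof.
move=> sA; rewrite /burned level_burned //; last by apply/card_gt0P; exists s.
by apply/setP => v; rewrite !inE lv_lt_card.
Qed.

Lemma level_valid b A : admissible b A -> valid e s b (level_strategy A).
Proof.
move=> [sA Ab]; have pos v (t : 'I_#|V|.+1) : (v, t) \in level_strategy A -> 0 < t.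
  rewrite inE /= => /andP[vA /eqP ->]; rewrite lt0n; apply: contraNneq sA.
  by move/lv0_root <-.
split=> // [v t vt|t].
  rewrite level_burned //; last exact: pos vt.
  by move: vt; rewrite !inE /= => /andP[_ /eqP ->]; rewrite ltnn.
apply: leq_trans (Ab t); apply: subset_leq_card; apply/subsetP => v.
by rewrite !inE /= eq_sym.
Qed.

End Rooted.

(** * Saved versus burned vertices for arbitrary strategies *)

Section Process.
Variables (V : finType) (e : rel V) (s : V).
Implicit Type Phi : strategy V.

(** On a path from the fire to [v], the first unburned vertex must be protected, because the fire
    has stabilised by time [#|V|]. *)
Lemma unburned_saved Phi v : v \notin burned e s Phi -> saved e s Phi v.
Proof.
move=> vB; apply/savedP; case: (boolP (v \in protected Phi)) => vP; [by left | right].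
move=> u p uB; elim: p u uB => [|w p IH] u uB /=; first by move=> _ uv; rewrite -uv uB in vB.
case/andP=> uw wp wv; case: (boolP (w \in protected Phi)) => wP.
  by exists w; rewrite // !inE eqxx orbT.
have [|x xp xP] := IH w _ wp wv; last by exists x; rewrite // inE xp orbT.
rewrite -(burned_stable e s Phi (leqnSn _)) burned_atS; last by apply/card_gt0P; exists s.
rewrite in_setU; apply/orP; right; rewrite inE; apply/andP; split; first exact: wP.
by apply/exists_inP; exists u.
Qed.

Lemma burned_atW Phi t t' : t <= t' -> burned_at e s Phi t \subset burned_at e s Phi t'.
Proof.
elim: t' => [|t' IH]; first by rewrite leqn0 => /eqP ->.
rewrite leq_eqVlt => /orP[/eqP ->//|]; rewrite ltnS => /IH sub.
apply: subset_trans sub _; case: t' {IH} => [|t'] //.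
by rewrite (burned_atS _ _ _ (ltn0Sn t')) subsetUl.
Qed.

(** By the empty path, a vertex both burned and saved would be protected; but validity keeps it
    unburned up to its protection, and the protection keeps it so afterwards. *)
Lemma saved_unburned b Phi v : valid e s b Phi -> saved e s Phi v -> v \notin burned e s Phi.
Proof.
move=> [pos safe _] /savedP sv; apply/negP => vB.
have vP : v \in protected Phi.
  by case: sv => // /(_ v [::] vB isT erefl) [w]; rewrite inE => /eqP ->.
move: vP; rewrite inE => /existsP[u /andP[_ uP]].
have stay t : u <= t -> v \notin burned_at e s Phi t.
  elim: t => [|t IH].
    by rewrite leqn0 => /eqP u0; have := pos _ _ uP; rewrite u0.
  rewrite leq_eqVlt => /orP[/eqP <-|]; first exact: safe uP.
  rewrite ltnS => ut; have t0 : 0 < t := leq_trans (pos _ _ uP) ut.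
  rewrite (burned_atS _ _ _ t0) inE negb_or IH // inE negb_and negbK.
  by apply/orP; left; rewrite inE; apply/existsP; exists u; rewrite ut.
by case/negP: (stay #|V| (ltn_ord u)).
Qed.

End Process.

Section Reduction.
Variables (V : finType) (e : rel V) (s : V) (par : V -> V) (lv : V -> nat).
Hypothesis R : rooted e s par lv.
Implicit Type A : {set V}.

(* Each protected vertex is replaced by its ancestor at the level that the fire
   reaches at the time of the protection. *)
Lemma reduce_to_levels b (Psi : strategy V) : valid e s b Psi ->
  exists2 A, admissible s lv b A & forall v, free par lv A v -> v \in burned e s Psi.
Proof.
move=> [pos safe cap].
pose A := [set v | [exists w, [exists u : 'I_#|V|.+1,
  [&& (w, u) \in Psi, u == lv v :> nat & anc par lv v w]]]].
have AP v w (u : 'I_#|V|.+1) : (w, u) \in Psi -> u = lv v :> nat -> anc par lv v w -> v \in A.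
  move=> wu uv vw; rewrite inE; apply/existsP; exists w; apply/existsP; exists u.
  by rewrite wu uv eqxx vw.
exists A; first split.
- apply/negP; rewrite inE => /existsP[w /existsP[u /and3P[wu /eqP u0 _]]].
  by have := pos _ _ wu; rewrite u0 (lv_root R).
- move=> i; case: (ltnP i #|V|.+1) => iV; last first.
    rewrite (_ : [set _ in _ | _] = set0) ?cards0 //; apply/setP => v; rewrite !inE.
    apply/negbTE; rewrite negb_and; apply/orP; right; apply/eqP => E.
    by have := lv_lt_card R v; lia.
  apply: leq_trans (cap (Ordinal iV)).
  (* Level [i] of [A] lies in the image of the set protected at time [i] under the map to the
     ancestor at level [i]. *)
  apply: leq_trans (leq_imset_card (fun w => iter (lv w - i) par w) _).
  apply: subset_leq_card; apply/subsetP => v.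
  rewrite inE => /andP[]; rewrite inE => /existsP[w /existsP[u /and3P[wu /eqP uE vw]]] /eqP vi.
  apply/imsetP; exists w.
    by rewrite inE (_ : Ordinal iV = u) //; apply: val_inj; rewrite /= uE.
  by rewrite -vi; case/andP: vw => _ /eqP.
have at_time n : forall v, lv v = n -> free par lv A v -> v \in burned_at e s Psi n.+1.
  elim: n => [|n IH] v vn fv; first by rewrite (lv0_root R vn) inE.
  have vs : v != s by apply: contra_eq_neq vn => ->; rewrite (lv_root R).
  move: (fv); rewrite (free_par R A vs) => /andP[_ fp].
  have pn : lv (par v) = n by have := lv_par R vs; lia.
  rewrite (burned_atS _ _ _ (ltn0Sn n)) inE; apply/orP; right; rewrite inE.
  apply/andP; split; last first.
    by apply/exists_inP; exists (par v); rewrite ?IH // (rooted_edge R) vs eqxx.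
  (* A protection of [v] at a time [u <= lv v] would put the ancestor of [v] at level [u] into [A],
     against freeness. *)
  apply/negP; rewrite inE => /existsP[u /andP[un vu]].
  have lw : lv (iter (lv v - u) par v) = u by rewrite (lv_iter_par R); lia.
  have := forall_inP fv _ (AP _ _ _ vu (esym lw) (iter_anc R _ _)).
  by rewrite (iter_anc R).
move=> v fv; apply: subsetP (burned_atW _ _ _ (lv_lt_card R v)) _ _.
exact: at_time fv.
Qed.

(** Two inclusions suffice: [A] saves at least the targets that are not free, and [Psi] saves at
    most the targets that are not free for its own [A']. *)
Lemma optimal_level b (S A : {set V}) : admissible s lv b A ->
  (forall A', admissible s lv b A' ->
    #|[set v in S | free par lv A v]| <= #|[set v in S | free par lv A' v]|) ->
  optimal e s b S (level_strategy lv A).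
Proof.
move=> adA best; split; first exact: (level_valid R).
move=> Psi vPsi; have [A' adA' burnedA'] := reduce_to_levels vPsi.
have saveA : [set v in S | ~~ free par lv A v] \subset
    [set v in S | saved e s (level_strategy lv A) v].
  apply/subsetP => v; rewrite !inE => /andP[-> fv] /=; apply: unburned_saved.
  by rewrite (level_burned_all R) ?inE //; case: adA.
apply: leq_trans (subset_leq_card saveA).
have savePsi : [set v in S | saved e s Psi v] \subset [set v in S | ~~ free par lv A' v].
  apply/subsetP => v; rewrite !inE => /andP[-> /(saved_unburned vPsi)] /=.
  by apply: contra; exact: burnedA'.
apply: leq_trans (subset_leq_card savePsi) _.
have split_free B : #|[set v in S | free par lv B v]| + #|[set v in S | ~~ free par lv B v]| = #|S|.
  rewrite -(cardsID [set v | free par lv B v] S); congr (_ + _); apply: eq_card => v;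
  by rewrite !inE // andbC.
by have := best _ adA'; have := split_free A; have := split_free A'; lia.
Qed.

End Reduction.

(** * Correctness of the algorithm *)

Lemma eq_membersP l1 l2 : reflect (l1 =i l2) (eq_members l1 l2).
Proof.
apply: (iffP andP) => [[/allP s12 /allP s21] x|E].
  by apply/idP/idP; [exact: s12 | exact: s21].
by split; apply/allP => x; rewrite E.
Qed.

Lemma same_keyP e1 e2 :
  reflect (e1.1.1 =i e2.1.1 /\ e1.1.2 =i e2.1.2) (same_key e1 e2).
Proof.
by apply: (iffP andP) => -[/eq_membersP H1 /eq_membersP H2].
Qed.

Lemma same_key_refl e : same_key e e.
Proof. by apply/same_keyP. Qed.

Lemma same_key_trans : transitive same_key.
Proof.
move=> y x z /same_keyP[H1 H2] /same_keyP[H3 H4]; apply/same_keyP.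
by split=> u; rewrite ?H1 ?H2.
Qed.

Lemma same_key_sym e1 e2 : same_key e1 e2 = same_key e2 e1.
Proof. by apply/same_keyP/same_keyP => -[H1 H2]; split=> u; rewrite ?H1 ?H2. Qed.

Lemma prune_sub L : {subset foldr insert [::] L <= L}.
Proof.
elim: L => //= e L IH x; rewrite /insert; case: ifP => _.
  by move/IH; rewrite inE orbC => ->.
rewrite !inE => /orP[->//|]; rewrite mem_filter => /andP[_ /IH ->].
by rewrite orbT.
Qed.

Lemma prune_pairwise L : pairwise (fun x y => ~~ same_key x y) (foldr insert [::] L).
Proof.
elim: L => //= e L IH; rewrite /insert; case: ifP => //= _.
by rewrite filter_all /= pairwise_filter.
Qed.

Lemma prune_dominates L e : e \in L ->
  exists2 e', e' \in foldr insert [::] L & same_key e e' /\ e'.2.1 <= e.2.1.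
Proof.
elim: L e => // x L IH e; rewrite inE => /orP[/eqP ->|/IH [e' e'L [k c]]] /=;
    rewrite /insert; case: ifP => [/hasP[y yL /andP[ky cy]]|/negbT /hasPn nh].
- by exists y.
- by exists x; [exact: mem_head | split=> //; exact: same_key_refl].
- by exists e'.
case: (boolP (same_key x e')) => kx; last first.
  by exists e' => //; rewrite inE mem_filter kx e'L orbT.
exists x; first exact: mem_head.
split; first by apply: same_key_trans k _; rewrite same_key_sym.
(* Here [x] evicts [e']: no kept entry with the key of [x] is as cheap as [x], so [e'] costs
   strictly more. *)
by have := nh _ e'L; rewrite kx /= -ltnNge => /ltnW h; apply: leq_trans h c.
Qed.

Lemma mem_lists_of (T : eqType) (vs : seq T) b C :
  (C \in lists_of vs b) = (size C == b) && all (mem vs) C.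
Proof.
elim: b C => [|b IH] C /=; first by rewrite inE; case: C.
apply/flattenP/andP => [[? /mapP[v vvs ->]] /mapP[C' C'L ->]|[]].
  by move: C'L; rewrite IH => /andP[Cb Ca]; rewrite /= eqSS Cb vvs.
case: C => // v C /= Cb /andP[vvs Cvs].
exists [seq v :: C | C <- lists_of vs b]; first by apply/mapP; exists v.
by apply/mapP; exists C; rewrite // IH -eqSS Cb.
Qed.

Section Correctness.
Variables (n : nat) (adj : rel 'I_n) (s : 'I_n) (S : {set 'I_n}) (b : nat).
Variables (par : 'I_n -> 'I_n) (lv : 'I_n -> nat).
Hypothesis R : rooted adj s par lv.
Implicit Types (A F : {set 'I_n}) (t : nat) (e : entry).

Let M := [seq [seq adj x y | y <- enum 'I_n] | x <- enum 'I_n].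
Let Sb := [seq x \in S | x <- enum 'I_n].
Let free := free par lv.

Lemma size_adjacency : size M = n.
Proof. by rewrite size_map size_enum_ord. Qed.

Lemma edgeE (x y : 'I_n) : edge M x y = adj x y.
Proof.
rewrite /edge (nth_map x) ?size_enum_ord // (nth_map x) ?size_enum_ord //.
by rewrite !nth_ord_enum.
Qed.

Lemma targetE (x : 'I_n) : nth false Sb x = (x \in S).
Proof. by rewrite (nth_map x) ?size_enum_ord // nth_ord_enum. Qed.

(** [perm_eq] also makes [l] duplicate-free, so that the lengths computed by the algorithm are
    cardinals. *)
Definition rep (l : seq nat) F := perm_eq l [seq val x | x <- enum F].

Lemma rep_mem l F (x : 'I_n) : rep l F -> (val x \in l) = (x \in F).
Proof.
by move/perm_mem ->; rewrite (mem_map val_inj) mem_enum.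
Qed.

Lemma repI (l : seq nat) F : uniq l -> (forall v, v \in l -> v < n) ->
  (forall x : 'I_n, (val x \in l) = (x \in F)) -> rep l F.
Proof.
move=> ul ln lF; apply: uniq_perm => //; first by rewrite map_inj_uniq ?enum_uniq //; exact: val_inj.
move=> v; apply/idP/mapP => [vl|[x]]; last by rewrite mem_enum -lF => ? ->.
by exists (Ordinal (ln v vl)); rewrite // mem_enum -lF.
Qed.

Lemma rep_uniq l F : rep l F -> uniq l.
Proof. by move/perm_uniq ->; rewrite map_inj_uniq ?enum_uniq //; exact: val_inj. Qed.

Lemma rep_ltn l F v : rep l F -> v \in l -> v < n.
Proof. by move/perm_mem -> => /mapP[x _ ->]; exact: ltn_ord x. Qed.

Lemma rep_filter l F (p : pred nat) : rep l F ->
  rep [seq v <- l | p v] [set x in F | p (val x)].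
Proof.
move=> lF; apply: repI; first by rewrite filter_uniq // (rep_uniq lF).
  by move=> v; rewrite mem_filter => /andP[_ /(rep_ltn lF)].
by move=> x; rewrite mem_filter (rep_mem _ lF) inE andbC.
Qed.

Lemma rep_size l F : rep l F -> size l = #|F|.
Proof. by move/perm_size ->; rewrite size_map cardE. Qed.

Lemma rep_eq l l' F F' : rep l F -> rep l' F' -> l =i l' -> F = F'.
Proof. by move=> lF lF' E; apply/setP => x; rewrite -(rep_mem x lF) E (rep_mem x lF'). Qed.

Definition front A t : {set 'I_n} := [set v | (lv v == t) && free A v].
(** Written with [(lv v).+1] so as to be empty at [t = 0], like the first list of [initial]. *)
Definition back A t : {set 'I_n} := [set v | ((lv v).+1 == t) && free A v].
Definition cost A t := #|[set v in S | (lv v <= t) && free A v]|.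

Definition keyed A t e := rep e.1.1 (back A t) /\ rep e.1.2 (front A t).

Lemma keyed_same A A' t e e' : keyed A t e -> keyed A' t e' -> same_key e e' ->
  keyed A t e'.
Proof.
move=> [r1 r2] [r1' r2'] /same_keyP[E1 E2]; split.
  by rewrite (rep_eq r1 r1' E1).
by rewrite (rep_eq r2 r2' E2).
Qed.

Lemma vertices_uniq N : uniq (vertices N).
Proof. by elim: N => // r N IH; rewrite vertices_cons /= IH mem_vertices ltnn. Qed.

(** The parent of a front vertex is free, as an ancestor of a free vertex, so it lies in [back A t];
    a child is two levels too deep to lie there. *)
Lemma candidates_rep A t e : keyed A t e ->
  rep (candidates M e) [set v | (lv v == t.+1) && free A (par v)].
Proof.
move=> [rp rc]; apply: repI.
- by rewrite filter_uniq // vertices_uniq.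
- by move=> v; rewrite mem_filter mem_vertices size_adjacency => /andP[].
move=> v; rewrite mem_filter mem_vertices size_adjacency ltn_ord andbT.
rewrite (rep_mem _ rp) !inE; apply/andP/andP => [[/hasP[u' u'c]]|[/eqP vt fv]].
  have [u uE] : exists u : 'I_n, u' = u by exists (Ordinal (rep_ltn rc u'c)).
  rewrite {}uE in u'c *; rewrite edgeE (rooted_edge R) (rep_mem _ rc) in u'c *.
  move: u'c; rewrite inE => /andP[/eqP ut fu].
  case/orP=> /andP[us /eqP E].
    have fp : free A (par u) := free_anc R (anc_par R u) fu.
    by case/negP; rewrite E fp andbT -ut (lv_par R us).
  by rewrite -E (lv_par R us) -E ut.
have vs : v != s by apply: contra_eq_neq vt => ->; rewrite (lv_root R).
have pt : lv (par v) = t by have := lv_par R vs; rewrite vt => -[].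
split; last by rewrite vt; apply/negP => /andP[/eqP ?]; lia.
apply/hasP; exists (val (par v)); first by rewrite (rep_mem _ rc) inE pt eqxx.
by rewrite edgeE (rooted_edge R) vs eqxx orbT.
Qed.

Lemma eq_free A A' v :
  (forall u, lv u <= lv v -> (u \in A) = (u \in A')) -> free A v = free A' v.
Proof.
move=> E; apply/forall_inP/forall_inP => H u; case: (leqP (lv u) (lv v)) => uv.
- by rewrite -E // => /H.
- by move=> _; apply/negP => /anc_lv; rewrite leqNgt uv.
- by rewrite E // => /H.
by move=> _; apply/negP => /anc_lv; rewrite leqNgt uv.
Qed.

Lemma costS A t : cost A t.+1 = cost A t + #|[set v in front A t.+1 | v \in S]|.
Proof.
rewrite /cost -(cardsID [set v | lv v == t.+1]) addnC; congr (_ + _); apply: eq_card => v;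
  rewrite !inE; case: (v \in S); case: (free A v); rewrite ?andbF ?andbT //=; lia.
Qed.

(** This serves both directions of the simulation: extending the strategy [A] of an entry by the
    choice [C], and following a given strategy, with [A' = A]. Membership in [C] matters only below
    a free parent. *)
Lemma advance_keyed A A' t i e C : keyed A t e ->
  (forall v, lv v <= t -> free A' v = free A v) ->
  (forall v, lv v = t.+1 -> free A (par v) -> (v \in A') = (val v \in C)) ->
  keyed A' t.+1 (advance M Sb i e C) /\
  (advance M Sb i e C).2.1 + cost A' t = e.2.1 + cost A' t.+1.
Proof.
move=> k fE AE.
have rnew : rep [seq v <- candidates M e | v \notin C] (front A' t.+1).
  have := rep_filter [pred v | v \notin C] (candidates_rep k).
  congr rep; apply/setP => v; rewrite !inE.
  case: eqP => //= vt; have vs : v != s by apply: contra_eq_neq vt => ->; rewrite (lv_root R).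
  rewrite /free (free_par R _ vs) -/free fE; last by have := lv_par R vs; lia.
  by rewrite andbC; case: (boolP (free A (par v))) => fp; rewrite ?andbF // AE.
split; first split=> //=.
  have [_ rc] := k; move: rc; congr rep; apply/setP => v; rewrite !inE eqSS.
  by case: eqP => //= vt; rewrite fE // vt.
rewrite /= (rep_size (rep_filter (nth false Sb) rnew)) costS addnAC -!addnA.
congr (_ + (_ + _)); apply: eq_card => v.
by rewrite !inE targetE.
Qed.

Definition state t := (rounds b M s Sb t).2.

Lemma rounds_time t : (rounds b M s Sb t).1 = t.+1.
Proof. by elim: t => //= t IH; rewrite IH. Qed.

Lemma stateS t : state t.+1 = foldr insert [::]
  (flatten [seq [seq advance M Sb t.+1 e C | C <- lists_of (vertices M) b] | e <- state t]).
Proof. by rewrite /state /rounds iterS /round [in LHS]rounds_time. Qed.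

Lemma mem_expand t e : e \in flatten [seq [seq advance M Sb t.+1 e C | C <- lists_of (vertices M) b] | e <- state t] ->
  exists2 e0, e0 \in state t & exists2 C, size C = b & e = advance M Sb t.+1 e0 C.
Proof.
case/flattenP => ? /mapP[e0 e0s ->] /mapP[C]; rewrite mem_lists_of => /andP[/eqP Cb _] ->.
by exists e0 => //; exists C.
Qed.

Lemma initial_keyed A : s \notin A -> keyed A 0 (initial s Sb) /\ (initial s Sb).2.1 = cost A 0.
Proof.
move=> sA; have r : rep [:: val s] (front A 0).
  apply: repI => // [v|x]; first by rewrite inE => /eqP ->; exact: ltn_ord.
  rewrite !inE val_eqE; apply/eqP/andP => [->|[/eqP /(lv0_root R)]//].
  by rewrite (lv_root R) eqxx /free (free_root R).
split; first by split => //=; apply: repI => // x; rewrite !inE.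
rewrite [LHS](rep_size (rep_filter (nth false Sb) r)); apply: eq_card => v.
by rewrite !inE targetE leqn0 andbC.
Qed.

Definition strategy_of e A := e.2.2 =i [seq (val v, lv v) | v <- enum A].

(** The strategy behind an entry is confined to the levels already processed, so a round extends it
    by one fresh level. *)
Definition sound t e A :=
  [/\ admissible s lv b A, forall v, v \in A -> lv v <= t, keyed A t e,
      e.2.1 = cost A t & strategy_of e A].

Lemma state_sound t e : e \in state t -> exists A, sound t e A.
Proof.
elim: t e => [|t IH] e.
  rewrite inE => /eqP ->; exists set0; have s0 : s \notin set0 by rewrite inE.
  have [k c] := initial_keyed s0; split=> //; last by move=> x; rewrite enum_set0.
    by split=> // i; rewrite (_ : [set _ in _ | _] = set0) ?cards0 //; apply/setP => v; rewrite !inE.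
  by move=> v; rewrite inE.
rewrite stateS => /prune_sub /mem_expand [e0 /IH [A [[sA Ab] At k c st]] [C Cb ->]].
(* Only the members of [C] that the fire is about to reach enter the strategy. *)
pose N := [set v | [&& lv v == t.+1, free A (par v) & val v \in C]].
have fE v : lv v <= t -> free (A :|: N) v = free A v.
  move=> vt; apply: eq_free => u uv; rewrite !inE.
  by case: eqP => [|_]; rewrite ?orbF //; lia.
have [k' c'] : keyed (A :|: N) t.+1 (advance M Sb t.+1 e0 C) /\
    (advance M Sb t.+1 e0 C).2.1 + cost (A :|: N) t = e0.2.1 + cost (A :|: N) t.+1.
  apply: advance_keyed k fE _ => v vt fv; rewrite !inE vt eqxx fv /=.
  by case: (boolP (v \in A)) => // /At; rewrite vt ltnn.
exists (A :|: N); split=> //.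
- split; first by rewrite !inE negb_or sA (lv_root R).
  move=> i; case: (ltngtP i t.+1) => it.
  + apply: leq_trans (Ab i); apply: subset_leq_card; apply/subsetP => v; rewrite !inE.
    by case/andP=> /orP[->//|/and3P[/eqP vt _ _]] /eqP vi; lia.
  + rewrite (_ : [set _ in _ | _] = set0) ?cards0 //; apply/setP => v; rewrite !inE.
    by apply/negP => /andP[/orP[/At|/and3P[/eqP vt _ _]] /eqP vi]; lia.
  rewrite -Cb cardE -(size_map val); apply: uniq_leq_size.
    by rewrite map_inj_uniq ?enum_uniq //; exact: val_inj.
  move=> x /mapP[v]; rewrite mem_enum inE in_setU it => /andP[vAN /eqP vt] ->.
  case/orP: vAN => [/At|]; first by rewrite vt ltnn.
  by rewrite inE => /and3P[].
- by move=> v; rewrite !inE => /orP[/At/leqW//|/and3P[/eqP ->]].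
- move: c'; rewrite c; suff -> : cost (A :|: N) t = cost A t by lia.
  apply: eq_card => v; rewrite !inE; case: leqP => vt //=; rewrite ?fE //.
rewrite /strategy_of => x; rewrite /= mem_cat st.
apply/orP/mapP => [[/mapP[v' v'C ->]|/mapP[v vA ->]]|[v]].
- move: v'C; rewrite mem_filter => /andP[v'C v'c].
  have rc := candidates_rep k; pose v := Ordinal (rep_ltn rc v'c).
  have := rep_mem v rc; rewrite v'c inE => /esym/andP[/eqP vt fv].
  by exists v; rewrite ?vt // mem_enum !inE vt eqxx fv [_ \in C]v'C orbT.
- by exists v => //; move: vA; rewrite !mem_enum inE => ->.
rewrite mem_enum inE => /orP[vA|]; rewrite ?inE.
  by move=> ->; right; apply/mapP; exists v; rewrite // mem_enum.
move=> /and3P[/eqP vt fv vC] ->; left; apply/mapP; exists (val v); rewrite ?vt //.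
by rewrite mem_filter vC (rep_mem _ (candidates_rep k)) inE vt eqxx.
Qed.

(** Pruning may replace the run of [A] by that of another strategy. This is harmless because the
    next key and the added cost depend on the key and the choice only; hence the invariant mentions
    just the key and the cost. *)
Lemma state_complete t A : admissible s lv b A ->
  exists2 e, e \in state t & keyed A t e /\ e.2.1 <= cost A t.
Proof.
move=> [sA Ab]; elim: t => [|t [e es [k c]]].
  by exists (initial s Sb); rewrite ?mem_head //; have [k ->] := initial_keyed sA.
pose C0 := [seq val v | v <- enum [set v in A | lv v == t.+1]].
have C0b : size C0 <= b by rewrite size_map -cardE.
(* Padding to length [b] uses [s], which has level 0 and so is never in question at level [t.+1]. *)
pose C := C0 ++ nseq (b - size C0) (val s).
have [k' c'] : keyed A t.+1 (advance M Sb t.+1 e C) /\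
    (advance M Sb t.+1 e C).2.1 + cost A t = e.2.1 + cost A t.+1.
  apply: advance_keyed k _ _ => // v vt fv; rewrite mem_cat (mem_map val_inj) mem_enum inE vt eqxx andbT.
  rewrite mem_nseq val_eqE (_ : (v == s) = false) ?andbF ?orbF //.
  by apply: contra_eqF vt => /eqP ->; rewrite (lv_root R).
have [|e' e'L [ke ce]] := @prune_dominates (flatten [seq [seq advance M Sb t.+1 e C |
   C <- lists_of (vertices M) b] | e <- state t]) (advance M Sb t.+1 e C).
  apply/flattenP; exists [seq advance M Sb t.+1 e C | C <- lists_of (vertices M) b].
    by apply/mapP; exists e.
  apply/mapP; exists C => //; rewrite mem_lists_of size_cat size_nseq subnKC // eqxx /=.
  apply/allP => v; rewrite mem_cat => /orP[/mapP[x _ ->]|/nseqP[-> _]] /=;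
  by rewrite mem_vertices size_adjacency ltn_ord.
rewrite -stateS in e'L; exists e' => //; split; last first.
  rewrite -(leq_add2r (cost A t)); apply: (leq_trans (leq_add ce (leqnn _))).
  by rewrite c' addnC leq_add2l.
have [A' [_ _ kA' _ _]] := state_sound e'L.
exact: keyed_same k' kA' ke.
Qed.

Lemma solve_optimal : exists l : seq ('I_n * 'I_#|'I_n|.+1),
  solve b M s Sb = [seq (val vt.1, val vt.2) | vt <- l] /\
  optimal adj s b S [set vt in l].
Proof.
rewrite /solve size_adjacency -/(state n.+1).
have lvn v : lv v < n by have := lv_lt_card R v; rewrite card_ord.
(* The empty strategy witnesses that the final state is not empty. *)
have ad0 : admissible s lv b set0.
  split=> [|i]; first by rewrite inE.
  by rewrite (_ : [set _ in _ | _] = set0) ?cards0 //; apply/setP => v; rewrite !inE.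
have [e0 e0s _] := state_complete n.+1 ad0.
have [A [adA _ _ cA stA]] := state_sound (mem_nth (initial s Sb) (leq_ltn_trans (leq0n _) (etrans (index_mem _ _) e0s))).
rewrite nth0 in cA stA; set e := head _ _ in cA stA *.
(* All levels are below [n], so at time [n.+1] the front, at level [n.+1], and the previous one, at
   level [n], are both empty. *)
have key0 A' e' : keyed A' n.+1 e' -> e'.1.1 =i [::] /\ e'.1.2 =i [::].
  move=> [r1 r2]; split=> v; apply/idP => vl.
    have := rep_mem (Ordinal (rep_ltn r1 vl)) r1; rewrite vl inE.
    by have := lvn (Ordinal (rep_ltn r1 vl)); rewrite eqSS; case: eqP => //; lia.
  have := rep_mem (Ordinal (rep_ltn r2 vl)) r2; rewrite vl inE.
  by have := lvn (Ordinal (rep_ltn r2 vl)); case: eqP => //; lia.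
(* All keys being equal, pruning leaves a single entry, which therefore competes with every
   admissible strategy. *)
have one e' : e' \in state n.+1 -> e' = e.
  have pw : pairwise (fun x y => ~~ same_key x y) (state n.+1) by rewrite stateS prune_pairwise.
  have all_same x y : x \in state n.+1 -> y \in state n.+1 -> same_key x y.
    move=> /state_sound [A1 [_ _ /key0 [E1 E2] _ _]] /state_sound [A2 [_ _ /key0 [E3 E4] _ _]].
    by apply/same_keyP; split=> u; rewrite ?E1 ?E2.
  rewrite /e; case: (state n.+1) pw all_same => //= x [|y L]; first by rewrite inE => _ _ /eqP.
  by move=> /andP[/andP[nk _] _] /(_ x y); rewrite !inE !eqxx orbT => /(_ isT isT); rewrite (negbTE nk).
have costE A' : cost A' n.+1 = #|[set v in S | free A' v]|.
  by apply: eq_card => v; rewrite !inE leqW // ltnW.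
have best A' : admissible s lv b A' ->
    #|[set v in S | free A v]| <= #|[set v in S | free A' v]|.
  move=> adA'; rewrite -!costE -cA.
  by have [e' /one -> []] := state_complete n.+1 adA'.
have stn v i : (v, i) \in e.2.2 -> v < n /\ i < #|'I_n|.+1.
  by rewrite stA => /mapP[x _ [-> ->]]; rewrite ltn_ord card_ord ltnS ltnW.
have [l lE] : exists l : seq ('I_n * 'I_#|'I_n|.+1), e.2.2 = [seq (val vt.1, val vt.2) | vt <- l].
  elim: (e.2.2) stn => [|[v i] L IH] stn; first by exists [::].
  have [|l ->] := IH; first by move=> v' i' vL; apply: stn; rewrite inE vL orbT.
  have [vn il] := stn v i (mem_head _ _).
  by exists ((Ordinal vn, Ordinal il) :: l).
exists l; split=> //; have := optimal_level R adA best; congr optimal.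
apply/setP => -[v i]; rewrite !inE /=.
have inj : injective (fun vt : 'I_n * 'I_#|'I_n|.+1 => (val vt.1, val vt.2)).
  by move=> [x1 x2] [y1 y2] /= [/val_inj -> /val_inj ->].
rewrite -(mem_map inj) /= -lE stA; apply/andP/mapP => [[vA /eqP vi]|[x]].
  by exists v; rewrite ?vi // mem_enum.
by rewrite mem_enum => xA [/val_inj -> ->]; rewrite xA eqxx.
Qed.

(** * Size of the states *)

Lemma state_uniq t : uniq [seq ([set x : 'I_n | val x \in e.1.1],
  [set x : 'I_n | val x \in e.1.2]) | e <- state t].
Proof.
case: t => // t; rewrite uniq_pairwise pairwise_map.
have : pairwise (fun x y => ~~ same_key x y) (state t.+1) by rewrite stateS prune_pairwise.
apply: (@sub_in_pairwise _ (mem (state t.+1))); last exact/allP.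
move=> x y /state_sound [A [_ _ [x1 x2] _ _]] /state_sound [B [_ _ [y1 y2] _ _]].
apply: contra => /eqP [/setP E1 /setP E2]; apply/same_keyP; split=> v.
  apply/idP/idP => vl; [have h := rep_ltn x1 vl | have h := rep_ltn y1 vl];
  by have := E1 (Ordinal h); rewrite !inE /= vl // => <-.
apply/idP/idP => vl; [have h := rep_ltn x2 vl | have h := rep_ltn y2 vl];
by have := E2 (Ordinal h); rewrite !inE /= vl // => <-.
Qed.

(** A key is a pair of consecutive fronts, each one of at most [m] sets, and pruning keeps one entry
    per key. At time 0 the previous front is the empty set. *)
Lemma size_state m t : 0 < m ->
  (forall t, exists2 X : seq {set 'I_n}, size X <= m &
     forall A, admissible s lv b A -> front A t \in X) ->
  size (state t) <= m ^ 2.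
Proof.
move=> m0 few.
have [X Xm XP] := few t.
have [Y Ym YP] : exists2 Y : seq {set 'I_n}, size Y <= m &
    forall A, admissible s lv b A -> back A t \in Y.
  case: t {X Xm XP} => [|t]; last by have [Y Ym YP] := few t; exists Y.
  exists [:: set0] => // A _; rewrite inE; apply/eqP/setP => v.
  by rewrite !inE.
rewrite -(size_map (fun e => ([set x : 'I_n | val x \in e.1.1],
  [set x : 'I_n | val x \in e.1.2]))).
apply: leq_trans (uniq_leq_size (state_uniq t) (s2 := [seq (y, x) | y <- Y, x <- X]) _) _.
  move=> _ /mapP[e /state_sound[A [adA _ [r1 r2] _ _]] ->].
  rewrite (_ : [set _ | _] = back A t); last by apply/setP => v; rewrite inE (rep_mem _ r1).
  rewrite (_ : [set x : 'I_n | val x \in e.1.2] = front A t); last first.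
    by apply/setP => v; rewrite inE (rep_mem _ r2).
  by apply: allpairs_f; [exact: YP | exact: XP].
by rewrite size_allpairs -mulnn leq_mul.
Qed.

Lemma size_strategy t e : e \in state t -> size e.2.2 <= t * n.
Proof.
elim: t e => [|t IH] e; first by rewrite inE => /eqP ->.
rewrite stateS => /prune_sub /mem_expand [e0 /IH st [C _ ->]] /=.
rewrite size_cat size_map mulSn leq_add // size_filter.
apply: leq_trans (count_size _ _) _; rewrite size_filter.
by apply: leq_trans (count_size _ _) _; rewrite size_vertices size_adjacency.
Qed.

Lemma dsz_rep l F : rep l F -> dsz l <= n * n.*2.+2 + 1.
Proof.
move=> lF; apply: leq_trans (dsz_seq_le (m := n.*2.+1) _) _.
  move=> l1 x l2 E; rewrite dsz_nat; have : x \in l by rewrite E mem_cat mem_head orbT.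
  by move/(rep_ltn lF); lia.
rewrite leq_add2r leq_mul2r (rep_size lF); apply/orP; right.
by apply: leq_trans (max_card _) _; rewrite card_ord.
Qed.

Lemma dsz_entry t e : t <= n.+1 -> e \in state t -> dsz e <= 17 * n.+1 ^ 3.
Proof.
move=> tn es; have [A [_ _ [r1 r2] c st]] := state_sound es.
have dstrat : dsz e.2.2 <= n.+1 * n * (4 * n).+4 + 1.
  apply: leq_trans (dsz_seq_le (m := (4 * n).+3) _) _.
    move=> l1 x l2 E; have : x \in e.2.2 by rewrite E mem_cat mem_head orbT.
    rewrite st => /mapP[v _ ->]; rewrite dsz_pair !dsz_nat.
    by have := lv_lt_card R v; rewrite card_ord; have := ltn_ord v; rewrite /=; lia.
  rewrite leq_add2r leq_mul2r; apply/orP; right.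
  by apply: leq_trans (size_strategy es) _; rewrite leq_mul2r tn orbT.
have dcost : dsz e.2.1 <= n.*2.+1.
  rewrite dsz_nat c ltnS leq_double -[X in _ <= X]card_ord; exact: max_card.
case: e es r1 r2 {c st} dstrat dcost => [[p q] [c l]] es /= r1 r2 dl dc.
rewrite !dsz_pair; have := dsz_rep r1; have := dsz_rep r2.
rewrite !expnS expn0; nia.
Qed.

Lemma dsz_rounds m t : 0 < m ->
  (forall t, exists2 X : seq {set 'I_n}, size X <= m &
     forall A, admissible s lv b A -> front A t \in X) ->
  t <= n.+1 -> dsz (rounds b M s Sb t) <= 18 * m ^ 2 * n.+1 ^ 3 + 2 * n + 10.
Proof.
move=> m0 few tn; rewrite [rounds _ _ _ _ _]surjective_pairing dsz_pair rounds_time dsz_nat.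
have : dsz (state t) <= size (state t) * (17 * n.+1 ^ 3).+1 + 1.
  apply: dsz_seq_le => l1 x l2 E; apply: (dsz_entry tn).
  by rewrite E mem_cat mem_head orbT.
have := size_state t m0 few; rewrite -/(state t) => le1 le2.
have : size (state t) * (17 * n.+1 ^ 3).+1 <= m ^ 2 * (18 * n.+1 ^ 3).
  apply: leq_mul => //; have : 0 < n.+1 ^ 3 by rewrite expn_gt0.
  by lia.
rewrite mulnA (mulnC (m ^ 2) 18); lia.
Qed.

End Correctness.

(** * Fronts *)

Section FewFronts.
Variables (V : finType) (e : rel V) (s : V) (par : V -> V) (lv : V -> nat) (b k : nat).
Hypothesis R : rooted e s par lv.
Variables z1 z2 : V.
Hypothesis tall : forall u v, anc par lv u v -> lv u + k <= lv v ->
  anc par lv u z1 || anc par lv u z2.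
Implicit Type A : {set V}.
Let anc := anc par lv.
Let free := free par lv.

Lemma card_window A t j : admissible s lv b A ->
  #|[set u in A | lv u <= t < lv u + j]| <= b * j.
Proof.
move=> [_ Ab]; elim: j => [|j IH].
  rewrite (_ : [set _ in _ | _] = set0) ?cards0 //; apply/setP => u; rewrite !inE addn0.
  by apply/negP => /and3P[_ ? ?]; lia.
have sub : [set u in A | lv u <= t < lv u + j.+1] \subset
    [set u in A | lv u <= t < lv u + j] :|: [set u in A | lv u == t - j].
  by apply/subsetP => u; rewrite !inE => /and3P[-> le lt] /=; lia.
apply: leq_trans (subset_leq_card sub) (leq_trans (leq_card_setU _ _) _).
by rewrite mulnS addnC leq_add.
Qed.

(** Kept as a set, possibly empty, so that it can be joined with the other vertices that determine a
    front. *)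
Definition topmost A z := [set u in A | anc u z & [forall w in A, anc w u ==> (w == u)]].

Lemma card_topmost A z : #|topmost A z| <= 1.
Proof.
apply/card_le1_eqP => u w; rewrite !inE.
move=> /and3P[uA uz /forall_inP uT] /and3P[wA wz /forall_inP wT].
case/orP: (leq_total (lv u) (lv w)) => le.
  by apply/esym/eqP; move/implyP: (wT u uA); apply; exact: (anc_chain R uz wz le).
by apply/eqP; move/implyP: (uT w wA); apply; exact: (anc_chain R wz uz le).
Qed.

Lemma topmostP A u z : u \in A -> anc u z -> exists2 w, w \in topmost A z & anc w u.
Proof.
move=> uA uz; have uP : (u \in A) && anc u z by rewrite uA.
have [w /andP[wA wz] wmin] := arg_minnP (P := fun w => (w \in A) && anc w z) lv uP.
exists w; last by apply: (anc_chain R wz uz (wmin u uP)).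
rewrite inE wA wz; apply/forall_inP => x xA; apply/implyP => xw.
rewrite -(@anc_at _ par lv x w) //; apply/eqP; rewrite eqn_leq (anc_lv xw) wmin //.
by rewrite xA; exact: (anc_trans R xw wz).
Qed.

Lemma front_reduce A t : admissible s lv b A -> exists2 A' : {set V}, #|A'| <= b * k + 2 &
  [set v | (lv v == t) && free A v] = [set v | (lv v == t) && free A' v].
Proof.
move=> adA; pose W := [set u in A | lv u <= t < lv u + k].
exists (W :|: (topmost A z1 :|: topmost A z2)).
  apply: leq_trans (leq_card_setU _ _) _; rewrite leq_add ?card_window //.
  by apply: leq_trans (leq_card_setU _ _) _; rewrite (leq_add (card_topmost _ _) (card_topmost _ _)).
apply/setP => v; rewrite !inE; case: eqP => //= vt; apply/idP/idP => /forall_inP fv.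
  apply/forall_inP => u; rewrite !inE => uA; apply: fv.
  by case/orP: uA => [|/orP[]] /andP[].
apply/forall_inP => u uA; apply/negP => uv.
(* The topmost element above [u] is also above [v], and it survives the reduction, so [v] is not
   free for the reduced set either. *)
have top z : anc u z -> topmost A z \subset topmost A z1 :|: topmost A z2 -> False.
  move=> uz /subsetP sub; have [w wT wu] := topmostP uA uz.
  by apply: (negP (fv w _)); [rewrite inE (sub _ wT) orbT | exact: (anc_trans R wu uv)].
case: (leqP (lv u + k) t) => ut.
  have /orP[uz|uz] : anc u z1 || anc u z2 by apply: tall uv _; rewrite vt.
    by apply: (top z1 uz); rewrite subsetUl.
  by apply: (top z2 uz); rewrite subsetUr.
by apply: (negP (fv u _)); [rewrite !inE uA ut -vt (anc_lv uv) | exact: uv].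
Qed.

Lemma few_fronts t : exists2 X : seq {set V}, size X <= #|V|.+1 ^ (b * k + 2) &
  forall A, admissible s lv b A -> [set v | (lv v == t) && free A v] \in X.
Proof.
(* Tuples of options enumerate the sets of at most [b * k + 2] vertices, with [None] as padding;
   hence the base [#|V|.+1]. *)
pose dec (w : (b * k + 2).-tuple (option V)) := [set x | Some x \in val w].
exists [seq [set v | (lv v == t) && free (dec w) v] | w <- enum {: (b * k + 2).-tuple (option V)}].
  by rewrite size_map -cardE card_tuple card_option.
move=> A /(@front_reduce A t) [A' cA' ->].
pose w := [seq Some x | x <- enum A'] ++ nseq (b * k + 2 - #|A'|) None.
have sw : size w == b * k + 2 by rewrite size_cat size_map size_nseq -cardE subnKC.
apply/mapP; exists (Tuple sw); first by rewrite mem_enum.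
suff -> : dec (Tuple sw) = A' by [].
apply/setP => x; rewrite inE /= mem_cat mem_map ?mem_enum; last by move=> ? ? [].
by case: (x \in A') => //=; apply/negbTE/nseqP => -[].
Qed.

End FewFronts.

(** * Rooting k-caterpillars *)

Section TreeRooted.
Variables (T : finType) (e : rel T) (r : T).
Hypothesis eT : is_tree e.

(** Connectedness is required inside [A], so that two neighbours of a new vertex are joined by a
    path avoiding it. *)
Definition rooted_on (A : {set T}) (par : T -> T) (lv : T -> nat) :=
  [/\ [/\ lv r = 0, par r = r & forall v, v \in A -> par v \in A],
      forall v, v \in A -> v != r -> lv v = (lv (par v)).+1,
      forall x y, x \in A -> y \in A ->
        e x y = (y != r) && (x == par y) || (x != r) && (y == par x)
    & forall x y, x \in A -> y \in A ->
        connect [rel x y | [&& e x y, x \in A & y \in A]] x y].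

(** [is_tree] only speaks of connections and cycles, so a rooting is built vertex by vertex:
    connectedness provides a vertex adjacent to [A], which becomes a new leaf. *)
Lemma rooted_grow m : m < #|T| ->
  exists (A : {set T}) par lv, [/\ r \in A, #|A| = m.+1 & rooted_on A par lv].
Proof.
have [esym eirr _ econ eacyc] := eT.
elim: m => [|m IH] mT.
  exists [set r], (fun=> r), (fun=> 0); rewrite set11 cards1; split=> //; split=> //.
  - by split=> // v _; rewrite set11.
  - by move=> v /set1P ->; rewrite eqxx.
  - by move=> x y /set1P -> /set1P ->; rewrite eirr eqxx.
  by move=> x y /set1P -> /set1P ->.
have [A [par [lv [rA cA [[lr pr parA] lvp edg con]]]]] := IH (ltnW mT).
have [x [y [xA yA xy]]] : exists x y, [/\ x \in A, y \notin A & e x y].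
  case: (boolP [exists x in A, exists y, (y \notin A) && e x y]).
    by case/exists_inP=> x xA /existsP[y /andP[yA xy]]; exists x, y.
  move=> /exists_inPn none; have clA : closed e (mem A).
    move=> x y xy; apply/idP/idP => [xA|yA].
      by have := none x xA; rewrite negb_exists => /forallP /(_ y); rewrite xy andbT negbK.
    have := none y yA; rewrite negb_exists => /forallP /(_ x).
    by rewrite esym xy andbT negbK.
  have : #|A| = #|T|.
    apply: eq_card => x; rewrite -(closed_connect clA (econ r x)); exact: rA.
  by rewrite cA => E; rewrite E ltnn in mT.
(* A second neighbour of [y] in [A] would be joined to [x] by a simple path in [A], which [y] closes
   to a cycle of length at least three. *)
have only u : u \in A -> e u y -> u = x.
  move=> uA uy; apply/eqP/negPn/negP => ux.
  have /connectP[p0 xp0 uE] := con x u xA uA.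
  case/shortenP: xp0 uE => p xp up _ uE {p0}.
  have : ucycle e [:: y, x & p].
    have pA : all (mem A) p.
      by elim: p x xp {up uE xA xy ux} => //= z p IHp x /andP[/and3P[_ _ ->] /IHp].
    rewrite /ucycle /= rcons_path -uE uy andbT esym xy; apply/andP; split.
      by apply: sub_path xp => a c /and3P[].
    rewrite inE negb_or; apply/andP; split; last exact: up.
    apply/andP; split; first by apply: contraNneq yA => ->.
    by apply/negP => /(allP pA) yA1; case/negP: yA.
  move/eacyc; case: p uE {xp up} => //= uE _.
  by rewrite uE eqxx in ux.
have yr : y != r by apply: contraNneq yA => ->.
have xny u : u \in A -> (u == y) = false by move=> uA; apply/eqP => E; rewrite -E uA in yA.
exists (y |: A), (fun v => if v == y then x else par v),
  (fun v => if v == y then (lv x).+1 else lv v).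
split; [by rewrite !inE rA orbT | by rewrite cardsU1 yA cA |].
have parN v : v \in A -> par v != y by move=> vA; rewrite xny ?parA.
split.
- rewrite !(eq_sym r) (negbTE yr); split=> // v; rewrite !inE.
  by case: eqP => [_|_ /parA ->]; rewrite ?xA orbT.
- move=> v; rewrite !inE => /orP[/eqP ->|vA] vr; first by rewrite eqxx xny.
  by rewrite xny // (negbTE (parN v vA)) lvp.
- move=> u v; rewrite !inE => /orP[/eqP ->|uA] /orP[/eqP ->|vA].
  + by rewrite eirr eqxx yr (eq_sym y x) xny.
  + rewrite eqxx xny // yr esym; apply/idP/orP => [/(only v vA) ->|[/andP[vr]|/eqP ->]].
    * by right; rewrite eqxx.
    * by rewrite eq_sym (negbTE (parN v vA)).
    * by [].
  + rewrite eqxx xny // yr /=; apply/idP/orP => [/(only u uA) ->|[/eqP ->|/andP[ur]]] //.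
    * by left.
    * by rewrite eq_sym (negbTE (parN u uA)).
  by rewrite !xny // edg.
have conA u v : u \in A -> v \in A ->
    connect [rel x0 y0 | [&& e x0 y0, x0 \in y |: A & y0 \in y |: A]] u v.
  move=> uA vA; apply: connect_sub (con u v uA vA) => a c /and3P[ac aA cA'].
  by apply: connect1; rewrite /= ac !inE aA cA' !orbT.
have cxy : connect [rel x0 y0 | [&& e x0 y0, x0 \in y |: A & y0 \in y |: A]] x y.
  by apply: connect1; rewrite /= xy !inE eqxx xA orbT.
have cyx : connect [rel x0 y0 | [&& e x0 y0, x0 \in y |: A & y0 \in y |: A]] y x.
  by apply: connect1; rewrite /= esym xy !inE eqxx xA orbT.
move=> u v; rewrite !inE => /orP[/eqP ->|uA] /orP[/eqP ->|vA]; first exact: connect0.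
- exact: connect_trans cyx (conA _ _ xA vA).
- exact: connect_trans (conA _ _ uA xA) cxy.
exact: conA.
Qed.

End TreeRooted.

(** * Changing the root *)

Definition rootable (V : finType) (e : rel V) (s : V) :=
  exists (par : V -> V) (lv : V -> nat), rooted e s par lv.

Lemma tree_rootable (T : finType) (e : rel T) (r : T) : is_tree e -> rootable e r.
Proof.
move=> eT; have T0 : 0 < #|T| by apply/card_gt0P; exists r.
have [|A [par [lv [rA cA [[lr pr _] lvp edg _]]]]] := @rooted_grow T e r eT #|T|.-1.
  by rewrite prednK.
have inA x : x \in A.
  have /eqP -> : A == [set: T] by rewrite eqEcard subsetT cardsT cA prednK /=.
  by rewrite inE.
by exists par, lv; split=> // [v|x y]; [exact: lvp | exact: edg].
Qed.

(** Reversing the edge between [r] and its child [s] changes the parents of these two only; levels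
    drop by one in the subtree of [s] and grow by one elsewhere. *)
Lemma reroot (V : finType) (e : rel V) (r s : V) par lv :
  rooted e r par lv -> s != r -> par s = r -> rootable e s.
Proof.
move=> R sr ps; have pr := par_root R.
pose below v := anc par lv s v.
have lvr := lv_root R; have lvs : lv s = 1 by rewrite (lv_par R sr) ps lvr.
have belowN v : v != r -> v != s -> below (par v) = below v.
  by move=> vr vs; rewrite /below (anc_parE R s vr) eq_sym (negbTE vs).
have below_gt0 v : below v -> 0 < lv v by move/anc_lv; rewrite lvs.
exists (fun v => if (v == r) || (v == s) then s else par v),
  (fun v => if below v then (lv v).-1 else (lv v).+1); split.
- by rewrite /below (anc_refl R) lvs.
- by rewrite eqxx orbT.
- move=> v vs; rewrite (negbTE vs) orbF; case: eqP => [->|/eqP vr].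
    by rewrite /below (anc_root R) (negbTE sr) lvr (anc_refl R) lvs.
  have E := lv_par R vr; have B := belowN v vr vs; rewrite B; case: ifP => bv.
    by have := below_gt0 (par v); rewrite B bv => /(_ isT); lia.
  by rewrite E.
move=> x y; rewrite (rooted_edge R).
have [->|xr] := eqVneq x r; have [->|yr] := eqVneq y r => //=.
- by rewrite (eq_sym r s) (negbTE sr).
- have [->|_] := eqVneq y s; first by rewrite ps (eq_sym r s) sr eqxx.
  by rewrite andbF.
- rewrite (eq_sym r s) sr /=.
  by have [->|_] := eqVneq x s; rewrite ?ps ?eqxx.
have [->|xs] := eqVneq x s; have [->|ys] := eqVneq y s => //=.
- by rewrite ps (negbTE sr).
- by rewrite ps (negbTE yr).
by rewrite ps (negbTE xr).
Qed.

(** The natural root after the replacement of edges has height 0, whereas the source may lie inside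
    a leg. The root travels to [s] one edge at a time, through [par s]. *)
Lemma rootable_any (V : finType) (e : rel V) (r s : V) : rootable e r -> rootable e s.
Proof.
move=> [par [lv R]]; move: {2}(lv s) (leqnn (lv s)) => m.
elim: m r s par lv R => [|m IH] r s par lv R.
  by rewrite leqn0 => /eqP /(lv0_root R) ->; exists par, lv.
have [->|sr] := eqVneq s r; first by move=> _; exists par, lv.
move=> sm; have pm : lv (par s) <= m by have := lv_par R sr; lia.
have [par' [lv' R']] := IH r (par s) par lv R pm.
have es : e (par s) s by rewrite (rooted_edge R) sr eqxx.
have sp : s != par s by apply/eqP => E; have := lv_par R sr; rewrite -E; lia.
apply: (reroot R' sp); move: es; rewrite (rooted_edge R') => /orP[/andP[_ /eqP]//|].
by rewrite eqxx.
Qed.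

Section Legs.
Variables (T : finType) (e0 : rel T) (len : T -> nat).
Hypothesis len_gt0 : forall x, 0 < len x.
Let U := {x : T & 'I_(len x)}.
Definition base (x : T) : U := Tagged (fun x => 'I_(len x)) (Ordinal (len_gt0 x)).
Definition height (u : U) : nat := tagged u.

Lemma height_lt (u : U) : height u < len (tag u).
Proof. exact: ltn_ord. Qed.

Lemma leg_eq (u v : U) : (u == v) = (tag u == tag v) && (height u == height v).
Proof.
case: u v => [x i] [y j]; rewrite /height /=.
apply/eqP/andP => [E|[/eqP E]].
  split; first by apply/eqP; exact: (congr1 tag E).
  by apply/eqP; exact: (congr1 height E).
by case: y / E j => j /eqP /val_inj ->.
Qed.

(** A leg hangs from its end of height 0, so parents decrease the height first and then follow
    [par]. The default of [insubd] only serves typing: the predecessor is in range. *)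
Definition leg_par (par : T -> T) (u : U) : U :=
  if height u is 0 then base (par (tag u))
  else Tagged (fun x => 'I_(len x)) (insubd (Ordinal (len_gt0 (tag u))) (height u).-1).

Lemma legs_rooted r par lv : rooted e0 r par lv ->
  rooted (replace_legs e0 (len := len)) (base r) (leg_par par) (fun u => lv (tag u) + height u).
Proof.
move=> R; have lvr := lv_root R; have pr := par_root R.
have tagP u : tag (leg_par par u) = if height u is 0 then par (tag u) else tag u.
  by rewrite /leg_par; case: (height u).
have heightP u : height (leg_par par u) = (height u).-1.
  have lt : (height u).-1 < len (tag u) := leq_ltn_trans (leq_pred _) (ltn_ord (tagged u)).
  rewrite /leg_par; case E: (height u) => [|i] //.
  by rewrite E /= in lt; rewrite {1}/height /= val_insubd lt.
split.
- by rewrite /= lvr.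
- by apply/eqP; rewrite leg_eq tagP heightP /= pr !eqxx.
- move=> u; rewrite leg_eq /= negb_and tagP heightP /height /=.
  case: (nat_of_ord (tagged u)) => [|i]; last by rewrite addnS.
  by rewrite eqxx orbF => /(lv_par R) ->; rewrite !addn0.
move=> u v; rewrite /replace_legs !leg_eq !tagP !heightP /=.
rewrite -/(height u) -/(height v) (_ : height (base r) = 0) //.
case: (height u) => [|i]; case: (height v) => [|j]; rewrite ?andbF ?andbT ?orbF /=.
- rewrite (rooted_edge R); have [->|//] := eqVneq (tag u) (tag v).
  have [//|vr] := eqVneq (tag v) r; rewrite orbb /=; apply/esym/negbTE/eqP => E.
  by have := lv_par R vr; rewrite -E => /n_Sn.
- by case: ifP => // _; rewrite eqSS eq_sym.
- by rewrite (eq_sym (tag v)); case: ifP => // _; rewrite eqSS eq_sym.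
rewrite (eq_sym (tag v)); case: ifP => // _.
by rewrite /= !eqSS (eq_sym j) (eq_sym i).
Qed.

End Legs.

Lemma rooted_transport (U V : finType) (eU : rel U) (eV : rel V) (f : V -> U) (g : U -> V) u :
  cancel f g -> cancel g f -> (forall x y, eV x y = eU (f x) (f y)) ->
  rootable eU u -> rootable eV (g u).
Proof.
move=> fK gK ef [par [lv R]]; have fI := can_inj fK.
have fu v : (v == g u) = (f v == u) by rewrite -(inj_eq fI) gK.
exists (g \o par \o f), (lv \o f); split=> /=.
- by rewrite gK (lv_root R).
- by rewrite gK (par_root R).
- by move=> v; rewrite fu gK => /(lv_par R).
by move=> x y; rewrite ef (rooted_edge R) !fu !(can2_eq fK gK) -!(inj_eq fI) !gK.
Qed.

(** Two adjacent vertices of degree at most one form a connected component, hence the whole tree. *)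
Lemma leaf_edge (T : finType) (e : rel T) x y z : is_tree e -> e x y ->
  x \notin spine e -> y \notin spine e -> (z == x) || (z == y).
Proof.
move=> [esym eirr _ econ _] xy; rewrite !inE -!leqNgt => dx dy.
have only a c : degree e a <= 1 -> e a c -> forall d, e a d -> d = c.
  by move=> /card_le1_eqP da ac d ad; apply: da; rewrite inE.
have cl : closed e (pred2 x y).
  have sub a c : e a c -> a \in pred2 x y -> c \in pred2 x y.
    move=> ac; rewrite !inE => /orP[/eqP E|/eqP E]; rewrite E in ac.
      by rewrite (only x y dx xy c ac) eqxx orbT.
    by rewrite (only y x dy _ c ac) ?eqxx // esym.
  move=> a c ac; apply/idP/idP; first exact: sub ac.
  by apply: sub; rewrite esym.
by have := closed_connect cl (econ x z); rewrite !inE eqxx => <-.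
Qed.

(** * Paths in a rooted tree *)

Section SpinePath.
Variables (V : finType) (e : rel V) (s : V) (par : V -> V) (lv : V -> nat).
Hypothesis R : rooted e s par lv.
Variables (q : nat -> V) (m : nat).
Hypothesis q_inj : forall i j, i <= m -> j <= m -> q i = q j -> i = j.
Hypothesis q_edge : forall i, i < m -> e (q i) (q i.+1).
Let anc := anc par lv.

Lemma q_par i : i < m ->
  (q i.+1 != s /\ par (q i.+1) = q i) \/ (q i != s /\ par (q i) = q i.+1).
Proof.
move/q_edge; rewrite (rooted_edge R) => /orP[/andP[? /eqP ->]|/andP[? /eqP ->]].
  by left.
by right.
Qed.

(** As a vertex has only one parent, an injective path climbs first and descends afterwards:
    climbing vertices are above the start, descending ones above the end. *)
Lemma path_anc_end i : i <= m -> anc (q i) (q 0) \/ anc (q i) (q m).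
Proof.
move=> im.
have down j : j < m -> par (q j) = q j.+1 -> anc (q j) (q 0).
  elim: j => [|j IH] jm pj; first exact: (anc_refl R).
  have jm' : j < m := ltnW jm.
  have [[_ E]|[_ E]] := q_par jm'.
    by rewrite pj in E; have := q_inj jm (ltnW jm') E; lia.
  by apply: (anc_trans R) (IH jm' E); rewrite -E; exact: (anc_par R).
have up d : forall j, j + d.+1 = m -> par (q j.+1) = q j -> anc (q j) (q m).
  elim: d => [|d IH] j jm pj.
    by rewrite -jm addn1 -pj; exact: (anc_par R).
  have jm' : j.+1 < m by lia.
  have [[_ E]|[_ E]] := q_par jm'.
    apply: (@anc_trans _ _ _ _ _ R (q j.+1)); first by rewrite -pj; exact: (anc_par R).
    by apply: IH => //; lia.
  by rewrite pj in E; have := q_inj _ _ E; lia.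
move: im; rewrite leq_eqVlt => /orP[/eqP ->|im]; first by right; exact: (anc_refl R).
have [[_ E]|[_ E]] := q_par im; last by left; exact: down.
by right; apply: (up (m - i).-1) => //; lia.
Qed.

(** Walking from [q i] back to [q 0], a step to a child keeps all ancestors, and a step to the
    parent loses only the vertex left, which is not [u]. *)
Lemma anc_whole_path u i : (forall j, j <= m -> u != q j) -> i <= m ->
  anc u (q i) -> anc u (q 0).
Proof.
move=> uq; elim: i => // i IH im ui; apply: IH (ltnW im) _.
have [[qs E]|[_ E]] := q_par im.
  by move: ui; rewrite /anc (anc_parE R _ qs) (negbTE (uq _ im)) E.
by apply: (anc_trans R ui); rewrite -E; exact: (anc_par R).
Qed.

End SpinePath.

(** The ends of the spine serve as [z1] and [z2]. A vertex off the spine is above the end [q 0], or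
    else every path descending from it stays inside one leg, which has at most [k] vertices. *)
Lemma caterpillar_structure k (V : finType) (e : rel V) (s : V) : 0 < k ->
  is_k_caterpillar k e ->
  exists (par : V -> V) (lv : V -> nat) (z1 z2 : V), rooted e s par lv /\
    forall u v, anc par lv u v -> lv u + k <= lv v ->
      anc par lv u z1 || anc par lv u z2.
Proof.
move=> k0 [T [e0 [len [f [[eT [p [up pS padj]]] lenk [g fK gK] ef]]]]].
have len_gt0 x : 0 < len x by have [/andP[]] := lenk x.
have len_le x : len x <= k by have [/andP[]] := lenk x.
have [par [lv R]] : rootable e s.
  pose r := tag (f s).
  have [par0 [lv0 R0]] := tree_rootable r eT.
  apply: (@rootable_any V e (g (base len_gt0 r))).
  apply: (rooted_transport fK gK ef); exists (leg_par len_gt0 par0).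
  by exists (fun u => lv0 (tag u) + height u); exact: legs_rooted.
exists par, lv; case: (p =P [::]) => [p0|/eqP pn].
  (* With an empty spine no edge is replaced and the tree has at most two vertices; if [u] were not
     [s], then [v], its parent and its grandparent would be three. *)
  exists s, s; split=> // u v uv uk.
  rewrite orbb (anc_root R); apply/negPn/negP => us.
  have noS x : x \notin spine e0 by rewrite -pS p0.
  have len1 x : len x = 1.
    have [_ H] := lenk x; apply/eqP/negPn/negP => /H [_ [y]].
    by rewrite (negbTE (noS y)).
  have inj : injective (fun v => tag (f v)).
    move=> a c E; apply: (can_inj fK); apply/eqP; rewrite leg_eq E eqxx /=.
    have := height_lt (f a); have := height_lt (f c).
    by rewrite !len1 !ltnS !leqn0 => /eqP -> /eqP ->.
  have lvu : 0 < lv u by rewrite lt0n; apply: contraNneq us => /(lv0_root R) ->.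
  have vs : v != s.
    by apply: contraTneq uk => ->; rewrite (lv_root R); lia.
  have pvs : par v != s.
    by apply/eqP => E; have := lv_par R vs; rewrite E (lv_root R); lia.
  have edge_tag a : a != s -> e0 (tag (f (par a))) (tag (f a)).
    move=> as_; have : e (par a) a by rewrite (rooted_edge R) as_ eqxx.
    rewrite ef /replace_legs; case: eqP => [/inj E|_ /and3P[]//].
    by have := lv_par R as_; rewrite E => /n_Sn.
  have /orP := leaf_edge (tag (f (par (par v)))) eT (edge_tag v vs) (noS _) (noS _).
  case=> /eqP /inj E.
    by have := lv_par R pvs; rewrite E => /n_Sn.
  by have := lv_par R pvs; have := lv_par R vs; rewrite E; lia.
have [x0 x0p] : exists x0, x0 \in p by case: (p) pn => // x0 ?; exists x0; exact: mem_head.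
pose q i := g (base len_gt0 (nth x0 p i)).
have [m mP] : exists m, size p = m.+1 by case: (p) pn => // ? p1; exists (size p1).
have q_inj i j : i <= m -> j <= m -> q i = q j -> i = j.
  move=> im jm /(can_inj gK) /(congr1 tag) /= E; apply/eqP.
  by rewrite -(nth_uniq x0 _ _ up) ?mP ?ltnS // E.
have inP i : i <= m -> nth x0 p i \in spine e0.
  by move=> im; rewrite -pS mem_nth // mP ltnS.
have q_edge i : i < m -> e (q i) (q i.+1).
  move=> im; rewrite ef !gK /replace_legs /=.
  rewrite (nth_uniq x0 _ _ up) ?mP ?ltnS // 1?ltnW // (ltn_eqF (ltnSn i)) andbT.
  rewrite padj ?inP // 1?ltnW // !index_uniq ?mP ?ltnS // 1?ltnW //.
  by rewrite !eqxx.
(* A spine vertex carries no leg: its length is 1, so only the point of height 0 lies over it. *)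
have spineq w : tag (f w) \in spine e0 -> exists2 i, i <= m & w = q i.
  rewrite -pS => wP; exists (index (tag (f w)) p); first by rewrite -ltnS -mP index_mem.
  apply: (can_inj fK); rewrite gK nth_index //; apply/eqP; rewrite leg_eq eqxx /=.
  have := height_lt (f w).
  suff -> : len (tag (f w)) = 1 by rewrite ltnS leqn0.
  have [_ H] := lenk (tag (f w)); apply/eqP/negPn/negP => /H [].
  by rewrite -pS wP.
exists (q 0), (q m); split=> // u v uv uk.
apply/orP; case: (boolP (tag (f u) \in spine e0)) => uS.
  by have [i im ->] := spineq u uS; exact: (path_anc_end R q_inj q_edge im).
left; apply/negPn/negP => nu.
have uq j : j <= m -> u != q j.
  by move=> jm; apply: contraNneq uS => ->; rewrite gK /= inP.
have offS w : anc par lv u w -> tag (f w) \notin spine e0.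
  move=> uw; apply/negP => /spineq [i im wE]; case/negP: nu.
  by apply: (anc_whole_path R q_edge uq im); rewrite -wE.
pose w i := iter i par v; pose d := lv v - lv u.
have lw i : lv (w i) = lv v - i by exact: (lv_iter_par R).
have wu i : i <= d -> anc par lv u (w i).
  by move=> id; apply: (anc_chain R uv (iter_anc R i v)); rewrite lw; have := anc_lv uv; rewrite /d in id; lia.
(* A change of tag would cross an edge of [e0] between two vertices off the spine; these would be
   the whole tree, but [x0] is on the spine. *)
have tagw i : i <= d -> tag (f (w i)) = tag (f v).
  elim: i => // i IH id; rewrite -(IH (ltnW id)).
  have wis : w i != s.
    by apply/eqP => E; have := lw i; rewrite E (lv_root R); rewrite /d in id; lia.
  have : e (w i.+1) (w i) by rewrite (rooted_edge R) wis eqxx.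
  rewrite ef /replace_legs; case: eqP => // _ /and3P[ww _ _].
  have := leaf_edge x0 eT ww (offS _ (wu _ id)) (offS _ (wu _ (ltnW id))).
  have x0S : x0 \in spine e0 by rewrite -pS.
  case/orP=> /eqP E; [have := offS _ (wu _ id) | have := offS _ (wu _ (ltnW id))];
  by rewrite -E x0S.
(* The [d.+1] vertices from [v] up to [u] have the same tag, hence distinct heights, so [d < k],
   against [uk]. *)
have : size [seq height (f (w i)) | i <- iota 0 d.+1] <= size (iota 0 (len (tag (f v)))).
  apply: uniq_leq_size.
    rewrite map_inj_in_uniq ?iota_uniq // => i j; rewrite !mem_iota !add0n !ltnS /= => id jd E.
    have : w i = w j by apply: (can_inj fK); apply/eqP; rewrite leg_eq E !tagw // !eqxx.
    move/(congr1 lv); rewrite !lw; rewrite /d in id jd; have := anc_lv uv; lia.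
  move=> h /mapP[i]; rewrite !mem_iota !add0n ltnS /= => id ->.
  by rewrite -(tagw i id); exact: height_lt.
rewrite size_map !size_iota; have := len_le (tag (f v)); rewrite /d; lia.
Qed.

Definition input (I : instance) : seq (seq bool) * (nat * seq bool) :=
  ([seq [seq adj x y | y <- enum 'I_(order I)] | x <- enum 'I_(order I)],
   (val (source I), [seq x \in targets I | x <- enum 'I_(order I)])).

Lemma enc_input I : enc (input I) = enc_instance I.
Proof.
rewrite /enc_instance /enc /Enc_prod /input /=; congr (Cons _ (Cons _ _)).
  rewrite /enc /Enc_seq; congr enc_seq; rewrite -map_comp; apply: eq_map => x /=.
  by rewrite /enc; congr enc_seq; rewrite -map_comp.
by rewrite /enc /Enc_seq; congr enc_seq; rewrite -map_comp.
Qed.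

Lemma PT_input A `{Ctx A} X `{Enc X} (F : A -> X) :
  (forall a, env a = [:: enc (F a)]) -> PT F.
Proof.
move=> envE; split.
  by apply: (PB_le PB_csize) => a; rewrite /csize envE /= /dsz; lia.
exists 0, (fun=> [::]), (fun=> EVar 0), (fun=> 1); split=> //; first exact: PB_const.
by move=> o Q _ a; exists 1 => //; rewrite envE; exact: (EvalVar Q [:: _] 0).
Qed.

Theorem theorem3 (k b : nat) (hk : 1 <= k) (hb : 1 <= b) :
  polytime_solvable enc_instance
    (fun I : instance => is_k_caterpillar k (@adj I))
    (max_save_solution b).
Proof.
set dom := fun I : instance => is_k_caterpillar k (@adj I).
pose C := {| env := fun i : {i | dom i} => [:: enc_instance (sval i)];
             size_env := fun _ => erefl 1 |} : Ctx {i | dom i}.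
(* The bound of [dsz_rounds], with [m] the number of fronts from [few_fronts]; the context contains
   only instances in the class, where this bound is available. *)
pose h (i : {i | dom i}) := let n := order (sval i) in
  18 * (n.+1 ^ (b * k + 2)) ^ 2 * n.+1 ^ 3 + 2 * n + 10.
have pin : PT (fun i : {i | dom i} => input (sval i)).
  by apply: PT_input => i; rewrite enc_input.
have pM := PT_1 pin; have pR := PT_2 pin.
have nB : PB (fun i : {i | dom i} => order (sval i)).
  have [MB _] := pM; apply: (PB_le MB) => i.
  pose proof (size_dsz (input (sval i)).1) as H; apply: leq_trans (ltnW H).
  by rewrite size_map size_enum_ord.
have n1B : PB (fun i : {i | dom i} => (order (sval i)).+1).
  by apply: (PB_le (PB_add nB (PB_const 1))) => i; rewrite addn1.
have hB : PB h.
  apply: PB_add (PB_const 10); apply: PB_add; last exact: PB_mul (PB_const 2) nB.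
  apply: PB_mul; last exact: PB_exp.
  by apply: PB_mul (PB_const 18) _; apply: PB_exp; exact: PB_exp.
have pS := PT_solve (b := b) hB _ pM (PT_1 pR) (PT_2 pR).
apply: (polytime_of_PT (pS _)) => [[I dI] t|I dI] /=.
  have [par [lv [z1 [z2 [R tall]]]]] := caterpillar_structure (source I) hk dI.
  rewrite size_map size_enum_ord => tn.
  apply: (dsz_rounds (targets I) R (m := (order I).+1 ^ (b * k + 2)) _ _ tn); first by rewrite expn_gt0.
  move=> t'; have [X Xm XP] := few_fronts b R tall t'.
  by exists X => //; rewrite card_ord in Xm.
have [par [lv [z1 [z2 [R tall]]]]] := caterpillar_structure (source I) hk dI.
have [l [lE opt]] := solve_optimal (targets I) b R.
exists l; split; last exact: opt.
rewrite lE /enc_strategy /enc /Enc_seq; congr enc_seq; rewrite -map_comp.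
exact: eq_map.
Qed.
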